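(* Let $A(\lambda)$, $B(\lambda)$ be the autoregressive and moving average polynomials of the context, let $F(\lambda)=A(\lambda)^{-1}B(\lambda)$ be irreducible, and let $R_1,\ldots,R_p\in\mathbb{C}^{d\times d}$ be a complete set of regular right solvents of $A(\lambda)$. Suppose $\sigma(A(\cdot))\subset(-\infty,0)+i\mathbb{R}$, $\mathbb{E}\|L(1)\|^2<\infty$ and $\mathbb{E}L(1)=0_m$, and let $$Y(t)=\sum_{k=1}^p\int_{-\infty}^t e^{R_k(t-u)}\,\mathrm{Res}[F,R_k]\,\mathrm{d}L(u),\qquad t\in\mathbb{R},$$ be the stationary MCARMA$(p,q)$ process. Then the covariance function $\gamma_Y(l)=\mathrm{Cov}(Y(t+l),Y(t))$, $l\in\mathbb{N}_0$, has the representation $$\gamma_Y(l)=\sum_{i=1}^p e^{lR_i}\,\Sigma_i,\qquad l\ge 0,$$ where $$\Sigma_i:=\sum_{j=1}^p\int_0^\infty e^{uR_i}\,\mathrm{Res}[F,R_i]\,\Sigma_L\,\mathrm{Res}[F,R_j]^{\mathsf H}\,e^{uR_j^{\mathsf H}}\,\mathrm{d}u .$$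
   Context: Let $d,m\ge 1$ be integers and $p>q$ positive integers. $L=(L(t))_{t\in\mathbb{R}}$ is a two-sided $\mathbb{R}^m$-valued Lévy process: $L(0)=0_m$ a.s., stationary and independent increments, càdlàg paths. $\Sigma_L$ denotes the covariance matrix of $L(1)$. Let $$A(\lambda)=I_d\lambda^p+A_1\lambda^{p-1}+\ldots+A_p,\qquad B(\lambda)=B_0\lambda^q+\ldots+B_{q-1}\lambda+B_q,$$ with $A_1,\ldots,A_p\in\mathbb{R}^{d\times d}$, $B_0,\ldots,B_q\in\mathbb{R}^{d\times m}$. Solvents: $\sigma(A(\cdot))=\{\lambda\in\mathbb{C}:\det A(\lambda)=0\}$, and $\sigma(R)$ is the set of eigenvalues of a matrix $R$. A matrix $R\in\mathbb{C}^{d\times d}$ is a right solvent of $A(\lambda)$ if $R^p+A_1R^{p-1}+\ldots+A_{p-1}R+A_p=0_{d\times d}$. It is regular if $\sigma(R)\cap\sigma(A^{(1)}(\cdot))=\emptyset$, where $A^{(1)}(\lambda)$ is the monic matrix polynomial of degree $p-1$ with $A(\lambda)=A^{(1)}(\lambda)(\lambda I_d-R)$. A set of right solvents $R_1,\ldots,R_p$ is complete if $\sigma(A(\cdot))=\bigcup_{k=1}^p\sigma(R_k)$. $F(\lambda)=A(\lambda)^{-1}B(\lambda)$ is irreducible if $A(\lambda)$ and $B(\lambda)$ are left coprime. For a regular right solvent $R$, the residue is $\mathrm{Res}[F,R]=\frac{1}{2\pi i}\oint_{\Gamma_R}F(\lambda)\,\mathrm{d}\lambda\in\mathbb{C}^{d\times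 m}$, where $\Gamma_R$ is a simple closed (positively oriented) contour with $\sigma(R)$ in its interior and $\sigma(A(\cdot))\setminus\sigma(R)$ in its exterior. $Z^{\mathsf H}$ denotes the complex conjugate transpose of a matrix $Z$, and $\mathrm{Cov}(U,W)=\mathbb{E}[(U-\mathbb{E}U)(W-\mathbb{E}W)^{\mathsf H}]$ for random vectors $U,W$. *)

(* Defs.v *)
From HB Require Import structures.
From mathcomp Require Import all_boot all_order all_algebra.
From mathcomp Require Import all_classical all_reals all_analysis.
From mathcomp Require Import complex spectral sesquilinear.

Set Implicit Arguments.
Unset Strict Implicit.
Unset Printing Implicit Defensive.

Import Order.TTheory GRing.Theory Num.Theory.
Import numFieldNormedType.Exports.

Local Open Scope classical_set_scope.
Local Open Scope ring_scope.
Local Open Scope sesquilinear_scope.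

(* [R[i]] with its usual topology (the one of the modulus). *)
HB.instance Definition _ (R : realType) := NormedModule.copy R[i] R[i]^o.

Section MatrixPolynomials.

(* The coefficient sequences are indexed as in A_1, ..., A_n and
   B_0, ..., B_n; the other values of [A] and [B] are irrelevant. *)
Definition ar_poly (K : nzRingType) (d n : nat) (A : nat -> 'M[K]_d) :
    'M[{poly K}]_d :=
  'X^n%:M + \sum_(1 <= k < n.+1) 'X^(n - k) *: map_mx polyC (A k).

Definition ma_poly (K : nzRingType) (d m n : nat) (B : nat -> 'M[K]_(d, m)) :
    'M[{poly K}]_(d, m) :=
  \sum_(0 <= k < n.+1) 'X^(n - k) *: map_mx polyC (B k).

Definition eval_mx (K : nzRingType) (d m : nat) (M : 'M[{poly K}]_(d, m))
    (z : K) : 'M[K]_(d, m) :=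
  map_mx (fun f : {poly K} => f.[z]) M.

(* Every common left divisor is unimodular. *)
Definition left_coprime (K : idomainType) (d m : nat) (M : 'M[{poly K}]_d)
    (N : 'M[{poly K}]_(d, m)) : Prop :=
  forall (D M' : 'M[{poly K}]_d) (N' : 'M[{poly K}]_(d, m)),
    M = D *m M' -> N = D *m N' -> D \in unitmx.

Definition poly_spectrum (K : fieldType) (d : nat) (M : 'M[{poly K}]_d) :
    set K :=
  [set z | \det (eval_mx M z) = 0].

Definition spectrum (K : fieldType) (d : nat) (S : 'M[K]_d) : set K :=
  [set z | eigenvalue S z].

Definition right_solvent (K : fieldType) (d p : nat) (A : nat -> 'M[K]_d)
    (S : 'M[K]_d) : Prop :=
  S ^+ p + \sum_(1 <= k < p.+1) A k *m S ^+ (p - k) = 0.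

(* [ar_poly p.-1 A1] is the monic right quotient A^(1) of A(lambda) by
   lambda I - S, which is unique. *)
Definition regular_right_solvent (K : fieldType) (d p : nat)
    (A : nat -> 'M[K]_d) (S : 'M[K]_d) : Prop :=
  right_solvent p A S /\
  exists2 A1 : nat -> 'M[K]_d,
    ar_poly p A = ar_poly p.-1 A1 *m ('X%:M - map_mx polyC S) &
    spectrum S `&` poly_spectrum (ar_poly p.-1 A1) = set0.

Definition complete_solvents (K : fieldType) (d p : nat) (A : nat -> 'M[K]_d)
    (S : 'I_p -> 'M[K]_d) : Prop :=
  poly_spectrum (ar_poly p A) = \bigcup_k spectrum (S k).

Definition expmx (R : realType) (d : nat) (M : 'M[R[i]]_d) : 'M[R[i]]_d :=
  lim (series (fun n : nat => (n`!%:R^-1 : R[i]) *: M ^+ n) @ \oo).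

End MatrixPolynomials.

Section ComplexIntegration.
Context (R : realType).

Definition c_mx (a b : nat) (M : 'M[R]_(a, b)) : 'M[R[i]]_(a, b) :=
  map_mx (real_complex R) M.

Definition sqnormc (z : R[i]) : R := complex.Re z ^+ 2 + complex.Im z ^+ 2.

Definition sqnorm_mx (a b : nat) (M : 'M[R[i]]_(a, b)) : R :=
  \sum_i \sum_j sqnormc (M i j).

Definition measurable_mx (disp : measure_display) (T : measurableType disp)
    (a b : nat) (f : T -> 'M[R[i]]_(a, b)) : Prop :=
  forall i j, measurable_fun setT (fun x => complex.Re (f x i j)) /\
              measurable_fun setT (fun x => complex.Im (f x i j)).

Definition integral_mx (disp : measure_display) (T : measurableType disp)
    (mu : {measure set T -> \bar R}) (D : set T) (a b : nat)
    (f : T -> 'M[R[i]]_(a, b)) : 'M[R[i]]_(a, b) :=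
  \matrix_(i, j) (Rintegral mu D (fun x => complex.Re (f x i j)) +i*
                  Rintegral mu D (fun x => complex.Im (f x i j)))%C.

Definition path_derivative (g : R -> R[i]) (s : R) : R[i] :=
  (derive1 (fun x : R => complex.Re (g x)) s +i*
   derive1 (fun x : R => complex.Im (g x)) s)%C.

Definition C1_path (g : R -> R[i]) : Prop :=
  [/\ forall s : R, derivable (fun x : R => complex.Re (g x)) s 1,
      forall s : R, derivable (fun x : R => complex.Im (g x)) s 1,
      continuous (derive1 (fun x : R => complex.Re (g x))) &
      continuous (derive1 (fun x : R => complex.Im (g x)))].

(* Paths are parametrized by [0, 1]; the values of [g] elsewhere are
   irrelevant, and each C^1 piece is C^1 up to its endpoints. *)
Definition piecewise_C1 (g : R -> R[i]) : Prop :=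
  exists2 t : seq R, path <%R 0 t /\ last 0 t = 1 &
    forall k : nat, (k < size t)%N ->
      exists2 h : R -> R[i], C1_path h &
        forall s : R, nth 0 (0 :: t) k <= s <= nth 0 t k -> g s = h s.

Definition simple_closed (g : R -> R[i]) : Prop :=
  g 0 = g 1 /\
  forall s t : R, 0 <= s < 1 -> 0 <= t < 1 -> g s = g t -> s = t.

Definition path_trace (g : R -> R[i]) : set R[i] := g @` `[0, 1]%classic.

Definition path_interior (g : R -> R[i]) : set R[i] :=
  [set z | ~ path_trace g z /\ bounded_set (connected_component (~` path_trace g) z)].

Definition path_exterior (g : R -> R[i]) : set R[i] :=
  [set z | ~ path_trace g z /\ ~ bounded_set (connected_component (~` path_trace g) z)].

Definition contour_integral (g : R -> R[i]) (a b : nat)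
    (f : R[i] -> 'M[R[i]]_(a, b)) : 'M[R[i]]_(a, b) :=
  integral_mx (@lebesgue_measure R) `[0, 1]%classic
    (fun s : R => path_derivative g s *: f (g s)).

Definition twopii : R[i] := (0 +i* (2 * pi))%C.

(* winding number 1 around the points of the interior *)
Definition positively_oriented (g : R -> R[i]) : Prop :=
  forall z : R[i], path_interior g z ->
    contour_integral g (fun w => ((w - z)^-1)%:M : 'M[R[i]]_1) = twopii%:M.

Definition residue_contour (d : nat) (M : 'M[{poly R[i]}]_d) (S : 'M[R[i]]_d)
    (g : R -> R[i]) : Prop :=
  [/\ piecewise_C1 g, simple_closed g, positively_oriented g,
      spectrum S `<=` path_interior g &
      poly_spectrum M `\` spectrum S `<=` path_exterior g].

Definition residue (d m : nat) (M : 'M[{poly R[i]}]_d)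
    (N : 'M[{poly R[i]}]_(d, m)) (g : R -> R[i]) : 'M[R[i]]_(d, m) :=
  twopii^-1 *:
    contour_integral g (fun z => invmx (eval_mx M z) *m eval_mx N z).

End ComplexIntegration.

Section Probability.
Context (R : realType) (disp : measure_display) (Omega : measurableType disp)
        (P : probability Omega R).

Definition mean_mx (a b : nat) (U : Omega -> 'M[R[i]]_(a, b)) :
    'M[R[i]]_(a, b) :=
  integral_mx P setT U.

Definition Cov (a b : nat) (U : Omega -> 'cV[R[i]]_a) (W : Omega -> 'cV[R[i]]_b) :
    'M[R[i]]_(a, b) :=
  mean_mx (fun w => (U w - mean_mx U) *m (W w - mean_mx W)^t*).

Definition cov_matrix (m : nat) (X : Omega -> 'cV[R]_m) : 'M[R]_m :=
  \matrix_(i, j)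
    fine (covariance P (fun w => X w i ord0) (fun w => X w j ord0)).

Definition borel_cV (m : nat) : set (set 'cV[R]_m) := <<s @open 'cV[R]_m >>.

Definition random_vector (m : nat) (X : Omega -> 'cV[R]_m) : Prop :=
  forall B : set 'cV[R]_m, borel_cV B -> measurable (X @^-1` B).

Definition independent_increments (m : nat) (L : R -> Omega -> 'cV[R]_m) :
    Prop :=
  forall (n : nat) (t : nat -> R) (B : nat -> set 'cV[R]_m),
    (forall k, (k < n)%N -> t k < t k.+1) ->
    (forall k, (k < n)%N -> borel_cV (B k)) ->
    fine (P (\bigcap_(k in `I_n) ((L (t k.+1) \- L (t k)) @^-1` B k))) =
    \prod_(k < n) fine (P ((L (t k.+1) \- L (t k)) @^-1` B k)).

Definition stationary_increments (m : nat) (L : R -> Omega -> 'cV[R]_m) :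
    Prop :=
  forall (s t h : R) (B : set 'cV[R]_m), s < t -> borel_cV B ->
    P ((L (t + h) \- L (s + h)) @^-1` B) = P ((L t \- L s) @^-1` B).

Definition cadlag (m : nat) (x : R -> 'cV[R]_m) : Prop :=
  forall t : R, x @ t^'+ --> x t /\ cvg (x @ t^'-).

Definition two_sided_levy (m : nat) (L : R -> Omega -> 'cV[R]_m) : Prop :=
  [/\ forall t, random_vector (L t),
      {ae P, forall w, L 0 w = 0},
      stationary_increments L,
      independent_increments L &
      {ae P, forall w, cadlag (fun t => L t w)}].

(* A matrix-valued step function, coded as a list of triples (a, b, C), each
   standing for C on the interval ]a, b] (and zero elsewhere). *)
Definition step_value (d m : nat) (s : seq (R * R * 'M[R[i]]_(d, m))) (u : R) :
    'M[R[i]]_(d, m) :=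
  \sum_(x <- s) (if x.1.1 < u <= x.1.2 then x.2 else 0).

Definition step_integral (d m : nat) (L : R -> Omega -> 'cV[R]_m)
    (s : seq (R * R * 'M[R[i]]_(d, m))) (w : Omega) : 'cV[R[i]]_d :=
  \sum_(x <- s) x.2 *m c_mx (L x.1.2 w - L x.1.1 w).

(* [X] is a version of the integral of the deterministic function [f] over the
   whole line with respect to a centred square-integrable L: the L^2(P) limit
   of the integrals of step functions converging to [f] in L^2(du). *)
Definition levy_integral (d m : nat) (L : R -> Omega -> 'cV[R]_m)
    (f : R -> 'M[R[i]]_(d, m)) (X : Omega -> 'cV[R[i]]_d) : Prop :=
  [/\ measurable_mx f, measurable_mx X &
    exists s : nat -> seq (R * R * 'M[R[i]]_(d, m)),
      [/\ forall n x, x \in s n -> x.1.1 <= x.1.2,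
          ((\int[@lebesgue_measure R]_u
              (sqnorm_mx (step_value (s n) u - f u))%:E)%E
            @[n --> \oo] --> 0%E) &
          ((\int[P]_w (sqnorm_mx (step_integral L (s n) w - X w))%:E)%E
            @[n --> \oo] --> 0%E)]].

Definition levy_integral_upto (d m : nat) (L : R -> Omega -> 'cV[R]_m) (t : R)
    (f : R -> 'M[R[i]]_(d, m)) (X : Omega -> 'cV[R[i]]_d) : Prop :=
  levy_integral L (fun u => if u <= t then f u else 0) X.

Definition mcarma_process (d m p : nat) (L : R -> Omega -> 'cV[R]_m)
    (S : 'I_p -> 'M[R[i]]_d) (M : 'I_p -> 'M[R[i]]_(d, m))
    (Y : R -> Omega -> 'cV[R[i]]_d) : Prop :=
  forall t : R, measurable_mx (Y t) /\
    exists2 I : 'I_p -> Omega -> 'cV[R[i]]_d,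
      forall k, levy_integral_upto L t
                  (fun u => expmx ((t - u)%:C%C *: S k) *m M k) (I k) &
      {ae P, forall w, Y t w = \sum_k I k w}.

End Probability.

(* Main.v *)
From HB Require Import structures.
Require Import Defs.
From mathcomp Require Import all_boot all_order all_algebra.
From mathcomp Require Import all_classical all_reals all_analysis.
From mathcomp Require Import measurable_realfun.
From mathcomp Require Import complex spectral sesquilinear.
From mathcomp Require Import ring lra.

Set Implicit Arguments.
Unset Strict Implicit.
Unset Printing Implicit Defensive.

Import Order.TTheory GRing.Theory Num.Theory.
Import numFieldNormedType.Exports.

Local Open Scope classical_set_scope.
Local Open Scope ring_scope.
Local Open Scope sesquilinear_scope.

(** The covariance of a sum of integrals [int f dL] is governed by an isometry.
    Write Sigma_L for the covariance of L(1), R_k for the solvents [S k] and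
    C_k for [Res k].  If X and Z are the integrals of f and g against L, then
    E X = 0 ([levy_integral_mean]) and E(X Z^H) is the integral of
    f Sigma_L g^H over the line ([levy_isometry]).  The kernels behind Y(t+l)
    and Y(t) are

      f_k(u) = exp((t+l-u) R_k) C_k  for u <= t+l,
      g_j(u) = exp((t-u) R_j) C_j    for u <= t,

    and zero elsewhere.  The product f_k Sigma_L g_j^H lives on u <= t, where
    the semigroup law ([expmxD]) writes it as exp(l R_k) times the value at
    v = t - u of

      exp(v R_k) C_k Sigma_L C_j^H exp(v R_j^H),

    since the adjoint of exp(v R_j) is exp(v R_j^H) ([expmx_adj]).  The
    reflection u |-> t - u ([cint_reflect]) turns the integral into one over
    [0, +oo[, the constant factor exp(l R_k) comes out ([integral_mx_mull]),
    and summing over k and j gives the formula.  All these integrals converge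
    because a function that is an L^2 limit of step functions is square
    integrable ([levy_integral_sqint]).

    The isometry holds for step functions ([step_isometry]) because
    increments of L over two intervals have covariance Sigma_L times the
    length of the intersection ([increment_cov]); it passes to L^2 limits by
    the Cauchy-Schwarz inequality ([ip_cvg]).

    The moments of the increments have to be recovered from those of L(1)
    alone ([scalar_increment]).  For a linear functional X of L: if a sum of
    two independent variables is square integrable, so are both terms
    ([indep_sqint]), hence X(h) - X(0) is square integrable for every h > 0.
    Its mean m(h) and second moment g(h) satisfy m(h+k) = m(h) + m(k) and
    g(h+k) = g(h) + g(k) + 2 m(h) m(k), so that m = 0 and g(h) = h g(1) at
    rational h.  Additivity alone does not reach the other h; right
    continuity of the paths and Fatou's lemma give g(h) <= h g(1).  Splitting
    an integer N into h and N - h, where m(N - h) = - m(h), then yields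
    N g(1) + 2 m(h)^2 = g(h) + g(N - h) <= N g(1), which forces both m(h) = 0
    and g(h) = h g(1). *)

(** * Square integrable real functions *)
Section SquareIntegrable.
Context {disp : measure_display} {T : measurableType disp} {R : realType}.
Variable mu : {measure set T -> \bar R}.
Implicit Types f g : T -> R.

Definition sqint f : Prop :=
  measurable_fun setT f /\ mu.-integrable setT (EFin \o (fun x => f x ^+ 2)).

Definition ip f g : R := \int[mu]_x (f x * g x).

Lemma sqint_le f g (c : R) : measurable_fun setT f ->
  (forall x, f x ^+ 2 <= c * g x ^+ 2) -> sqint g -> sqint f.
Proof.
move=> mf fg [mg ig]; split=> //.
apply: (@le_integrable _ _ _ mu setT measurableT _
   (fun x => (c%:E * (EFin \o (fun x => g x ^+ 2)%R) x)%E)).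
- by apply/measurable_EFinP; exact: measurable_funX.
- move=> x _ /=; rewrite lee_fin ger0_norm ?sqr_ge0//.
  by rewrite (le_trans (fg x))// ler_norm.
- exact: integrableZl.
Qed.

Lemma sqint0 : sqint (fun=> 0).
Proof.
split; first exact: measurable_cst.
by under [_ \o _]eq_fun do rewrite /= expr0n/=; exact: integrable0.
Qed.

Lemma sqintZ f (c : R) : sqint f -> sqint (fun x => c * f x).
Proof.
move=> sf; apply: (@sqint_le _ f (c ^+ 2)) => // [|x].
  by apply: measurable_funM => //; case: sf.
by rewrite exprMn.
Qed.

Lemma sqintD f g : sqint f -> sqint g -> sqint (fun x => f x + g x).
Proof.
move=> [mf jf] [mg jg]; split; first exact: measurable_funD.
apply: (@le_integrable _ _ _ mu setT measurableT _
  (fun x => 2%:E * ((EFin \o (fun x => f x ^+ 2)%R) \+ (EFin \o (fun x => g x ^+ 2)%R)) x)%E).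
- by apply/measurable_EFinP; apply: measurable_funX; exact: measurable_funD.
- move=> x _ /=; rewrite lee_fin ger0_norm ?sqr_ge0//.
  rewrite (le_trans _ (ler_norm _))//.
  by have := sqr_ge0 (f x - g x); nra.
- by apply: integrableZl => //; exact: integrableD.
Qed.

Lemma sqintB f g : sqint f -> sqint g -> sqint (fun x => f x - g x).
Proof.
move=> sf sg.
rewrite (_ : (fun x => _) = fun x => f x + (-1) * g x); last first.
  by apply/funext => x; rewrite mulN1r.
by apply: sqintD => //; exact: sqintZ.
Qed.

Lemma sqint_sum (I : Type) (s : seq I) (P : pred I) (F : I -> T -> R) :
  (forall i, sqint (F i)) -> sqint (fun x => \sum_(i <- s | P i) F i x).
Proof.
move=> sF; elim: s => [|i s ih].
  by under eq_fun do rewrite big_nil; exact: sqint0.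
under eq_fun do rewrite big_cons; case: (P i) => //; exact: sqintD.
Qed.

Lemma integrable_sqintM f g : sqint f -> sqint g ->
  mu.-integrable setT (EFin \o (fun x => f x * g x)).
Proof.
move=> [mf jf] [mg jg].
apply: (@le_integrable _ _ _ mu setT measurableT _
  ((EFin \o (fun x => f x ^+ 2)%R) \+ (EFin \o (fun x => g x ^+ 2)%R))%E).
- by apply/measurable_EFinP; exact: measurable_funM.
- move=> x _ /=; rewrite lee_fin (le_trans _ (ler_norm _))//.
  have := sqr_ge0 (f x - g x); have := sqr_ge0 (f x + g x).
  by rewrite ler_norml => h1 h2; apply/andP; split; nra.
- exact: integrableD.
Qed.

Lemma ipC f g : ip f g = ip g f.
Proof. by apply: eq_Rintegral => x _; rewrite mulrC. Qed.

Lemma ipDl f1 f2 g : sqint f1 -> sqint f2 -> sqint g ->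
  ip (fun x => f1 x + f2 x) g = ip f1 g + ip f2 g.
Proof.
move=> s1 s2 sg; rewrite /ip -RintegralD//; try exact: integrable_sqintM.
by apply: eq_Rintegral => x _; rewrite mulrDl.
Qed.

Lemma ipZl f g (c : R) : sqint f -> sqint g ->
  ip (fun x => c * f x) g = c * ip f g.
Proof.
move=> s1 s2; rewrite /ip -RintegralZl//; last exact: integrable_sqintM.
by apply: eq_Rintegral => x _; rewrite mulrA.
Qed.

Lemma ipDr f1 f2 g : sqint f1 -> sqint f2 -> sqint g ->
  ip g (fun x => f1 x + f2 x) = ip g f1 + ip g f2.
Proof. by move=> s1 s2 sg; rewrite ipC ipDl// ![ip g _]ipC. Qed.

Lemma ipZr f g (c : R) : sqint f -> sqint g ->
  ip g (fun x => c * f x) = c * ip g f.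
Proof. by move=> sf sg; rewrite ipC ipZl// ipC. Qed.

Lemma ip0l g : ip (fun=> 0) g = 0.
Proof.
rewrite /ip; under eq_Rintegral do rewrite mul0r.
by rewrite /Rintegral integral0.
Qed.

Lemma ipBl f1 f2 g : sqint f1 -> sqint f2 -> sqint g ->
  ip (fun x => f1 x - f2 x) g = ip f1 g - ip f2 g.
Proof.
move=> s1 s2 sg; rewrite /ip -RintegralB//; try exact: integrable_sqintM.
by apply: eq_Rintegral => x _; rewrite mulrBl.
Qed.

Lemma ipBr f1 f2 g : sqint f1 -> sqint f2 -> sqint g ->
  ip g (fun x => f1 x - f2 x) = ip g f1 - ip g f2.
Proof. by move=> s1 s2 sg; rewrite ipC ipBl// ![ip g _]ipC. Qed.

Lemma ip_sqrD f g : sqint f -> sqint g ->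
  ip (fun x => f x + g x) (fun x => f x + g x) = ip f f + 2 * ip f g + ip g g.
Proof.
move=> sf sg; have sfg := sqintD sf sg.
by rewrite ipDl// !(ipDr sf sg)// (ipC g f); ring.
Qed.

Lemma ip_suml (I : Type) (s : seq I) (P : pred I) (F : I -> T -> R) g :
  (forall i, sqint (F i)) -> sqint g ->
  ip (fun x => \sum_(i <- s | P i) F i x) g = \sum_(i <- s | P i) ip (F i) g.
Proof.
move=> sF sg; elim: s => [|i s ih].
  by under eq_fun do rewrite big_nil; rewrite big_nil ip0l.
under eq_fun do rewrite big_cons; rewrite big_cons; case: (P i) => //.
by rewrite ipDl ?ih//; exact: sqint_sum.
Qed.

Lemma ip_sumr (I : Type) (s : seq I) (P : pred I) (F : I -> T -> R) g :
  (forall i, sqint (F i)) -> sqint g ->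
  ip g (fun x => \sum_(i <- s | P i) F i x) = \sum_(i <- s | P i) ip g (F i).
Proof.
by move=> sF sg; rewrite ipC ip_suml//; apply: eq_bigr => i _; rewrite ipC.
Qed.

Lemma ip_ge0 f : 0 <= ip f f.
Proof. by apply: Rintegral_ge0 => x _; rewrite -expr2 sqr_ge0. Qed.

(** The quadratic form (a, b) |-> ip (a f + b g) (a f + b g) is nonnegative, so
    its discriminant is nonpositive. *)
Lemma cauchy_schwarz_ip f g : sqint f -> sqint g ->
  `|ip f g| <= Num.sqrt (ip f f) * Num.sqrt (ip g g).
Proof.
move=> sf sg.
have q (a b : R) : 0 <= a ^+ 2 * ip f f + 2 * a * b * ip f g + b ^+ 2 * ip g g.
  have sa := sqintZ a sf; have sb := sqintZ b sg.
  have := ip_ge0 (fun x => a * f x + b * g x).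
  rewrite ipDl//; last exact: sqintD.
  rewrite !ipDr// !ipZl// !ipZr// (ipC g f).
  by move=> h; apply: le_trans h _; rewrite le_eqVlt; apply/orP; left; apply/eqP; ring.
have sq : ip f g ^+ 2 <= ip f f * ip g g.
  have [C0|C0] := ltrP 0 (ip g g).
    (* the minimizing direction b / a = - ip f g / ip g g *)
    have h := q (ip g g) (- ip f g); rewrite -subr_ge0 -(pmulr_rge0 _ C0).
    by apply: le_trans h _; rewrite le_eqVlt; apply/orP; left; apply/eqP; ring.
  have {}C0 : ip g g = 0 by apply/le_anti; rewrite C0 ip_ge0.
  have [->|B0] := eqVneq (ip f g) 0; first by rewrite expr0n/= mulr_ge0// ip_ge0.
  (* now the form is affine in b; this b gives it the value -1 *)
  have := q 1 (- (ip f f + 1) / (2 * ip f g)); rewrite C0 mulr0 addr0 => h.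
  exfalso; move: h; rewrite (_ : _ + _ = -1) ?oppr_ge0 ?ler10//.
  by field.
rewrite -sqrtrM ?ip_ge0//; apply: le_trans (ler_wsqrtr sq).
by rewrite sqrtr_sqr.
Qed.

Lemma ip_cvg_left (h : nat -> T -> R) (k : nat -> T -> R) (c : R) :
  (forall n, sqint (h n)) -> (forall n, sqint (k n)) ->
  ip (h n) (h n) @[n --> \oo] --> 0 -> ip (k n) (k n) @[n --> \oo] --> c ->
  ip (h n) (k n) @[n --> \oo] --> 0.
Proof.
move=> sh sk h0 k0; apply/norm_cvg0P.
apply: (@squeeze_cvgr _ _ _ _ (fun=> 0)
  (fun n => Num.sqrt (ip (h n) (h n)) * Num.sqrt (ip (k n) (k n)))).
- by apply: nearW => n; rewrite normr_ge0 cauchy_schwarz_ip.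
- exact: cvg_cst.
- rewrite -(mul0r (Num.sqrt c)) -[X in X * _]sqrtr0.
  have csqrt (u : nat -> R) l : u n @[n --> \oo] --> l ->
      Num.sqrt (u n) @[n --> \oo] --> Num.sqrt l.
    by move=> ul; apply: (@continuous_cvg _ _ _ _ _ _ Num.sqrt) ul; exact: sqrt_continuous.
  by apply: cvgM; exact: csqrt.
Qed.

(** Expanding ip (h n) (k n) around (f, g) leaves three terms, each with a
    factor that tends to 0 in L^2 against one that stays bounded. *)
Lemma ip_cvg (h k : nat -> T -> R) f g :
  (forall n, sqint (h n)) -> (forall n, sqint (k n)) -> sqint f -> sqint g ->
  ip (fun x => h n x - f x) (fun x => h n x - f x) @[n --> \oo] --> 0 ->
  ip (fun x => k n x - g x) (fun x => k n x - g x) @[n --> \oo] --> 0 ->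
  ip (h n) (k n) @[n --> \oo] --> ip f g.
Proof.
move=> sh sk sf sg hf kg.
have shf n : sqint (fun x => h n x - f x) by exact: sqintB.
have skg n : sqint (fun x => k n x - g x) by exact: sqintB.
have -> : (fun n => ip (h n) (k n)) = fun n =>
    ip (fun x => h n x - f x) (fun x => k n x - g x) +
    ip (fun x => h n x - f x) g + ip (fun x => k n x - g x) f + ip f g.
  apply/funext => n.
  by rewrite !ipBl// !ipBr// (ipC (k n)) (ipC g); ring.
rewrite -[X in _ --> X]add0r; apply: cvgD; last exact: cvg_cst.
rewrite -(addr0 0); apply: cvgD.
  rewrite -(addr0 0); apply: cvgD; first exact: ip_cvg_left kg.
  by apply: (@ip_cvg_left _ (fun=> g) (ip g g)) => //; exact: cvg_cst.
by apply: (@ip_cvg_left _ (fun=> f) (ip f f)) => //; exact: cvg_cst.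
Qed.

(** L^2 convergence of square integrable functions, given in the extended
    reals where the first integrals may be infinite, is L^2 convergence to a
    square integrable function. *)
Lemma sqint_limit (h : nat -> T -> R) f : (forall n, sqint (h n)) ->
  measurable_fun setT f ->
  (\int[mu]_x ((h n x - f x) ^+ 2)%:E @[n --> \oo] --> 0)%E ->
  sqint f /\ ip (fun x => h n x - f x) (fun x => h n x - f x) @[n --> \oo] --> 0.
Proof.
move=> sh mf hf.
have mhf n : measurable_fun setT (fun x => h n x - f x).
  by apply: measurable_funB => //; case: (sh n).
have [N _ /(_ N (leqnn N)) fN] : \forall n \near \oo,
    (\int[mu]_x ((h n x - f x) ^+ 2)%:E \is a fin_num)%E.
  by have /fine_cvgP[] := hf.
have sf : sqint f.
  have -> : f = (fun x => h N x - (h N x - f x)) by apply/funext => x; ring.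
  apply: sqintB => //; split => //; apply/integrableP; split.
    by apply/measurable_EFinP; exact: measurable_funX.
  under eq_integral do rewrite /= ger0_norm ?sqr_ge0//.
  by rewrite ltey_eq fN.
split => //.
have /fine_cvgP[_] := hf.
by under eq_fun do (rewrite /comp -/(Rintegral _ _ _)).
Qed.

End SquareIntegrable.

(** * Independent and identically distributed variables *)
Section Independence.
Context {disp : measure_display} {Omega : measurableType disp} {R : realType}.
Variable P : probability Omega R.
Implicit Types X Y : Omega -> R.

Definition indep X Y : Prop := forall A B : set R,
  measurable A -> measurable B ->
  P (X @^-1` A `&` Y @^-1` B) = (P (X @^-1` A) * P (Y @^-1` B))%E.

(** Independence says that the joint law is the product of the marginal laws on
    rectangles, hence on all measurable sets; then Tonelli applies. *)
Lemma indep_integral X Y (f : R * R -> \bar R) :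
  measurable_fun setT X -> measurable_fun setT Y -> indep X Y ->
  measurable_fun setT f -> (forall z, 0 <= f z)%E ->
  (\int[P]_w f (X w, Y w) = \int[P]_w \int[P]_w' f (X w, Y w'))%E.
Proof.
move=> mX mY XY mf f0.
pose Xm : {mfun Omega >-> R} := HB.pack X (isMeasurableFun.Build _ _ _ _ _ mX).
pose Ym : {mfun Omega >-> R} := HB.pack Y (isMeasurableFun.Build _ _ _ _ _ mY).
have mXY : measurable_fun setT (fun w => (X w, Y w)) by exact: measurable_fun_pair.
pose XYm : {mfun Omega >-> (R * R)%type} :=
  HB.pack (fun w => (X w, Y w)) (isMeasurableFun.Build _ _ _ _ _ mXY).
rewrite -[LHS](@ge0_integral_pushforward _ _ _ _ _ _ mXY P setT f)//.
rewrite (@eq_measure_integral _ _ _ _ (distribution P Xm \x distribution P Ym)%E); last first.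
  move=> A mA _; apply/esym.
  apply: (@product_measure_unique _ _ _ _ _
    (distribution P Xm) (distribution P Ym) (distribution P XYm)) mA.
  by move=> B C mB mC; exact: XY.
rewrite fubini_tonelli1//.
rewrite ge0_integral_pushforward//=.
- apply: eq_integral => w _ /=; rewrite /fubini_F ge0_integral_pushforward//.
  exact: measurableT_comp.
- exact: measurable_fun_fubini_tonelli_F.
- by move=> w _; apply: integral_ge0.
Qed.

(** The function (x, y) |-> (x + y)^2 is the one test function through which
    independence is used below. *)
Lemma measurable_sumsq : measurable_fun setT
  (fun z : R * R => ((z.1 + z.2) ^+ 2)%:E).
Proof.
by apply/measurable_EFinP; apply: measurable_funX; exact: measurable_funD.
Qed.

Lemma sqint_cst (c : R) : sqint P (fun=> c).
Proof.
by split; [exact: measurable_cst | exact: finite_measure_integrable_cst].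
Qed.

(** As an inner product with 1, so that linearity and passage to L^2 limits are
    those of [ip]. *)
Definition mean X : R := ip P X (fun=> 1).

Lemma meanD X Y : sqint P X -> sqint P Y ->
  mean (fun w => X w + Y w) = mean X + mean Y.
Proof. by move=> sX sY; rewrite /mean ipDl//; exact: sqint_cst. Qed.

Lemma integral_sqr X : sqint P X -> (\int[P]_w (X w ^+ 2)%:E = (ip P X X)%:E)%E.
Proof.
move=> [mX iX]; rewrite /ip /Rintegral fineK.
  by apply: eq_integral => w _; rewrite expr2.
by have := integrable_fin_num measurableT iX; under eq_integral do rewrite /= expr2.
Qed.

Lemma sqint_fin X : measurable_fun setT X ->
  (\int[P]_w (X w ^+ 2)%:E < +oo)%E -> sqint P X.
Proof.
move=> mX h; split=> //; apply/integrableP; split.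
  by apply/measurable_EFinP; exact: measurable_funX.
by under eq_integral do rewrite /= ger0_norm ?sqr_ge0//.
Qed.

Lemma ip_shift X (c : R) : sqint P X ->
  ip P (fun w => c + X w) (fun w => c + X w) = c ^+ 2 + 2 * c * mean X + ip P X X.
Proof.
move=> sX; have s1 := sqint_cst c.
have ce : ip P (fun=> c) (fun=> c) = c ^+ 2.
  by rewrite /ip /Rintegral integral_cst//= probability_setT mule1.
have cX : ip P (fun=> c) X = c * mean X.
  rewrite /mean -(ipZr c (sqint_cst 1) sX) ipC.
  by congr (ip _ _ _); apply/funext => w; rewrite mulr1.
rewrite ipDl//; last exact: sqintD.
by rewrite !ipDr// ce (ipC _ X) cX; ring.
Qed.

(** By Tonelli, E(X + Y)^2 is the average over w of E(X(w) + Y)^2.  As it is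
    finite, some E(x + Y)^2 is finite, and Y differs from x + Y by a constant. *)
Lemma indep_sqint X Y : measurable_fun setT X -> measurable_fun setT Y ->
  indep X Y -> sqint P (fun w => X w + Y w) -> sqint P X /\ sqint P Y.
Proof.
move=> mX mY XY sXY.
have sY : sqint P Y.
  have [w wfin] : exists w, (\int[P]_w' ((X w + Y w') ^+ 2)%:E < +oo)%E.
    apply: contrapT => /forallNP h.
    have : (\int[P]_w ((X w + Y w) ^+ 2)%:E = +oo)%E.
      rewrite (indep_integral mX mY XY measurable_sumsq); last first.
        by move=> z; rewrite lee_fin sqr_ge0.
      rewrite (eq_integral (cst +oo%E)); last first.
        by move=> w _; apply/eqP; rewrite -leye_eq leNgt; apply/negP/h.
      by rewrite integral_cst//= probability_setT mule1.
    by rewrite integral_sqr.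
  have -> : Y = (fun w' => (X w + Y w') - X w) by apply/funext => w'; ring.
  apply: sqintB; last exact: sqint_cst.
  by apply: sqint_fin => //; exact: measurable_funD.
split=> //.
have -> : X = (fun w => (X w + Y w) - Y w) by apply/funext => w; ring.
exact: sqintB.
Qed.

(** Computing E(X + Y)^2 by Tonelli gives E X^2 + 2 (E X)(E Y) + E Y^2; expanding
    the square gives the same expression with E(XY) in the middle. *)
Lemma indep_ip X Y : sqint P X -> sqint P Y -> indep X Y ->
  ip P X Y = mean X * mean Y.
Proof.
move=> sX sY XY; have [mX _] := sX; have [mY _] := sY.
have sXY := sqintD sX sY.
have f0 (z : R * R) : (0 <= ((z.1 + z.2) ^+ 2)%:E)%E by rewrite lee_fin sqr_ge0.
have := indep_integral mX mY XY measurable_sumsq f0; rewrite /= integral_sqr//.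
under [RHS]eq_integral => w _.
  rewrite (integral_sqr (X := fun w' => X w + Y w')); last first.
    by apply: sqintD => //; exact: sqint_cst.
  rewrite ip_shift//; over.
move=> /(congr1 fine)/=; rewrite -/(Rintegral _ _ _).
have s1 := sqint_cst 1.
have -> : \int[P]_w (X w ^+ 2 + 2 * X w * mean Y + ip P Y Y) =
    ip P X (fun w => X w + (2 * mean Y) * 1) + ip P (fun=> 1) (fun=> ip P Y Y * 1).
  rewrite -RintegralD//.
  - by apply: eq_Rintegral => w _ /=; ring.
  - by apply: integrable_sqintM => //; apply: sqintD => //; exact: sqintZ.
  - by apply: integrable_sqintM => //; exact: sqintZ.
have i11 : ip P (fun=> 1) (fun=> 1) = 1.
  by rewrite /ip /Rintegral integral_cst//= probability_setT mule1/= mulr1.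
have sz (c : R) : sqint P (fun=> c * 1) by exact: sqint_cst.
have zE Z (c : R) : sqint P Z -> ip P Z (fun=> c * 1) = c * ip P Z (fun=> 1).
  exact: (@ipZr _ _ _ P (fun=> 1)).
rewrite (ipDr sX (sz _) sX) !zE// i11 (ipDr sX sY sXY) !ipDl//.
rewrite (ipC _ Y X) -/(mean X) => e; lra.
Qed.

Definition eqlaw X Y : Prop := forall A : set R, measurable A ->
  P (X @^-1` A) = P (Y @^-1` A).

Lemma eqlaw_integral X Y (f : R -> \bar R) :
  measurable_fun setT X -> measurable_fun setT Y -> eqlaw X Y ->
  measurable_fun setT f -> (forall z, 0 <= f z)%E ->
  (\int[P]_w f (X w) = \int[P]_w f (Y w))%E.
Proof.
move=> mX mY XY mf f0.
pose Xm : {mfun Omega >-> R} := HB.pack X (isMeasurableFun.Build _ _ _ _ _ mX).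
pose Ym : {mfun Omega >-> R} := HB.pack Y (isMeasurableFun.Build _ _ _ _ _ mY).
rewrite -[LHS](@ge0_integral_pushforward _ _ _ _ _ _ mX P setT f)//.
rewrite -[RHS](@ge0_integral_pushforward _ _ _ _ _ _ mY P setT f)//.
rewrite (@eq_measure_integral _ _ _ _ (distribution P Ym))//.
by move=> A mA _; exact: XY.
Qed.

(** The laws determine E(c + X)^2 for every c, which is the integral of a
    nonnegative function; c = 0 and c = 1 recover the moments of order 2
    and 1. *)
Lemma eqlaw_sqint X Y : measurable_fun setT Y -> eqlaw X Y -> sqint P X ->
  [/\ sqint P Y, ip P Y Y = ip P X X & mean Y = mean X].
Proof.
move=> mY XY sX; have [mX _] := sX.
have e (c : R) : (\int[P]_w ((c + X w) ^+ 2)%:E = \int[P]_w ((c + Y w) ^+ 2)%:E)%E.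
  apply: (eqlaw_integral (f := fun x => ((c + x) ^+ 2)%:E)) => //.
    apply/measurable_EFinP; apply: measurable_funX; exact: measurable_funD.
  by move=> z; rewrite lee_fin sqr_ge0.
have sY : sqint P Y.
  apply: sqint_fin => //; have := e 0.
  under eq_integral do rewrite add0r.
  under [RHS]eq_integral do rewrite add0r.
  by move=> <-; rewrite integral_sqr// ltry.
have e' (c : R) : c ^+ 2 + 2 * c * mean X + ip P X X = c ^+ 2 + 2 * c * mean Y + ip P Y Y.
  rewrite -!ip_shift//; apply: EFin_inj; rewrite -!integral_sqr//; apply: sqintD => //;
  exact: sqint_cst.
have := e' 0; have := e' 1; rewrite !expr0n/= expr1n => h1 h0.
by split=> //; lra.
Qed.

End Independence.

Section AlmostEverywhere.
Context {disp : measure_display} {Omega : measurableType disp} {R : realType}.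
Variable P : probability Omega R.

Lemma sqint_ae (X Y : Omega -> R) : measurable_fun setT Y ->
  {ae P, forall w, X w = Y w} -> sqint P X -> sqint P Y.
Proof.
move=> mY XY sX; have [mX _] := sX; apply: sqint_fin => //.
rewrite -(ge0_ae_eq_integral (f := fun w => (X w ^+ 2)%:E))//.
- by rewrite integral_sqr// ltry.
- by apply/measurable_EFinP; exact: measurable_funX.
- by apply/measurable_EFinP; exact: measurable_funX.
- by move=> w _; rewrite lee_fin sqr_ge0.
- by move=> w _; rewrite lee_fin sqr_ge0.
- by apply: filterS XY => w /= ->.
Qed.

Lemma ip_ae (X Y X' Y' : Omega -> R) :
  measurable_fun setT X -> measurable_fun setT Y ->
  measurable_fun setT X' -> measurable_fun setT Y' ->
  {ae P, forall w, X w = X' w} -> {ae P, forall w, Y w = Y' w} ->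
  ip P X Y = ip P X' Y'.
Proof.
move=> mX mY mX' mY' XX YY; rewrite /ip /Rintegral; congr fine.
apply: ae_eq_integral => //.
- by apply/measurable_EFinP; exact: measurable_funM.
- by apply/measurable_EFinP; exact: measurable_funM.
- by apply: filterS2 XX YY => w /= -> ->.
Qed.

End AlmostEverywhere.

(** * Moments of the increments of a scalar process *)
Section ScalarIncrements.
Context {disp : measure_display} {Omega : measurableType disp} {R : realType}.
Variable P : probability Omega R.
Variable X : R -> Omega -> R.
Hypothesis mX : forall t, measurable_fun setT (X t).
Hypothesis X_stat : forall s t h, s < t ->
  eqlaw P (fun w => X (t + h) w - X (s + h) w) (fun w => X t w - X s w).
Hypothesis X_indep : forall s t u, s < t -> t < u ->
  indep P (fun w => X t w - X s w) (fun w => X u w - X t w).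
Hypothesis X_rc : {ae P, forall w, forall t, X u w @[u --> t^'+] --> X t w}.

Let D (h : R) (w : Omega) : R := X h w - X 0 w.
Let m h := mean P (D h).
Let g h := ip P (D h) (D h).

Hypothesis D1 : sqint P (D 1).
Hypothesis m1 : m 1 = 0.

Let mD h : measurable_fun setT (D h).
Proof. exact: measurable_funB. Qed.

Let DD h k w : D (h + k) w = D h w + (X (k + h) w - X h w).
Proof. by rewrite /D (addrC h); ring. Qed.

Let law h k : 0 < k -> eqlaw P (fun w => X (k + h) w - X h w) (D k).
Proof. by move=> k0; have := X_stat h k0; rewrite add0r. Qed.

Let lawN h k : 0 < k -> eqlaw P (D k) (fun w => X (k + h) w - X h w).
Proof. by move=> k0 A mA; rewrite law. Qed.

Let ind h k : 0 < h -> 0 < k -> indep P (D h) (fun w => X (k + h) w - X h w).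
Proof. by move=> h0 k0; apply: X_indep => //; rewrite ltrDr. Qed.

Let mXB s t : measurable_fun setT (fun w => X s w - X t w).
Proof. exact: measurable_funB. Qed.

(** D (h + k) is the sum of D h and an independent increment. *)
Let D_split h k : 0 < h -> 0 < k -> sqint P (D (h + k)) -> sqint P (D h).
Proof.
move=> h0 k0 s; have [] // := @indep_sqint _ _ _ P _ _ (mD h) (mXB (k + h) h) (ind h0 k0).
by under eq_fun do rewrite -DD.
Qed.

Let D_add h k : 0 < h -> 0 < k -> sqint P (D h) -> sqint P (D k) ->
  [/\ sqint P (D (h + k)), m (h + k) = m h + m k &
      g (h + k) = g h + g k + 2 * m h * m k].
Proof.
move=> h0 k0 sh sk.
have [sk' gk' mk'] := eqlaw_sqint (mXB _ _) (lawN h k0) sk.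
have E : D (h + k) = fun w => D h w + (X (k + h) w - X h w) by apply/funext => w.
split; first by rewrite E; exact: sqintD.
  by rewrite /m E meanD// mk'.
rewrite /g E (ip_sqrD sh sk') (indep_ip sh sk' (ind h0 k0)).
by rewrite mk' gk' -/(m h) -/(m k); ring.
Qed.

(** Downwards from 1 by splitting, upwards from 1 by adding unit increments. *)
Let sD h : 0 < h -> sqint P (D h).
Proof.
have H1 k : 0 < k -> k <= 1 -> sqint P (D k).
  rewrite le_eqVlt => k0 /predU1P[->//|k1].
  by apply: (@D_split _ (1 - k)); rewrite ?subr_gt0// addrC subrK.
move=> h0; have : h <= (Num.trunc h).+1%:R by rewrite ltW// truncnS_gt.
move: (Num.trunc h).+1 => n; elim: n h h0 => [h h0 /(lt_le_trans h0)|n ih h h0 hn].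
  by rewrite ltxx.
have [h1|h1] := leP h 1; first exact: H1.
have -> : h = 1 + (h - 1) by ring.
have h10 : 0 < h - 1 by rewrite subr_gt0.
have sh1 : sqint P (D (h - 1)) by apply: ih => //; rewrite lerBlDr natr1.
by have [] := D_add ltr01 h10 D1 sh1.
Qed.

Let m_mul h n : 0 < h -> m (n.+1%:R * h) = n.+1%:R * m h.
Proof.
move=> h0; elim: n => [|n ih]; first by rewrite !mul1r.
rewrite -natr1 !mulrDl !mul1r -ih.
have nh : 0 < n.+1%:R * h by rewrite mulr_gt0.
by have [_ ->] := D_add nh h0 (sD nh) (sD h0).
Qed.

Let m_rat k n : m (k.+1%:R / n.+1%:R) = 0.
Proof.
have n0 : 0 < (n.+1%:R : R)^-1 by rewrite invr_gt0.
rewrite m_mul//; have := m_mul n n0; rewrite mulfV// m1 => /esym/eqP.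
by rewrite mulf_eq0 pnatr_eq0/= => /eqP ->; rewrite mulr0.
Qed.

Let g_rat k n : g (k.+1%:R / n.+1%:R) = k.+1%:R / n.+1%:R * g 1.
Proof.
have n0 : 0 < (n.+1%:R : R)^-1 by rewrite invr_gt0.
have gk j : g (j.+1%:R / n.+1%:R) = j.+1%:R * g (n.+1%:R^-1).
  elim: j => [|j ih]; first by rewrite !mul1r.
  rewrite -natr1 !mulrDl !mul1r -ih.
  have jn : 0 < (j.+1%:R : R) / n.+1%:R by rewrite divr_gt0.
  have [_ _ ->] // := @D_add _ _ jn n0 (sD jn) (sD n0).
  by rewrite m_rat mulr0 mul0r addr0.
rewrite gk; have := gk n; rewrite mulfV// => ->.
by rewrite -mulrA mulKf.
Qed.

(** Fatou's lemma along rational times t(n) decreasing to h, where the second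
    moment is known. *)
Let g_le h : 0 < h -> g h <= h * g 1.
Proof.
move=> h0.
(* the least multiple of 1/(n+1) that is greater than h *)
pose t n : R := (Num.trunc (h * n.+1%:R)).+1%:R / n.+1%:R.
have ht n : h < t n by rewrite ltr_pdivlMr// truncnS_gt.
have tub n : t n <= h + n.+1%:R^-1.
  rewrite /t ler_pdivrMr// mulrDl mulVf// -natr1 lerD2r.
  by rewrite truncn_le// mulr_ge0// ltW.
have tcvg : t n @[n --> \oo] --> h.
  apply: (@squeeze_cvgr _ _ _ _ (fun=> h) (fun n => h + n.+1%:R^-1)).
  - by apply: nearW => n; rewrite tub ltW.
  - exact: cvg_cst.
  - rewrite -[X in _ --> X]addr0; apply: cvgD; first exact: cvg_cst.
    exact: cvg_harmonic.
have tr : t n @[n --> \oo] --> h^'+.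
  move=> A /= [e /= e0 eA].
  have te := tcvg (ball h e) (nbhsx_ballx h e e0).
  apply: (@filterS _ \oo _ (t @^-1` ball h e) _ _ te) => n tn.
  by apply: (eA (t n)) => //; exact: ht.
rewrite -lee_fin -(integral_sqr (sD h0)).
have mt n : measurable_fun setT (fun w => ((D (t n) w) ^+ 2)%:E).
  by apply/measurable_EFinP; exact: measurable_funX.
have mlim : measurable_fun setT (fun w => limn_einf (fun n => ((D (t n) w) ^+ 2)%:E)).
  (* a lower limit is minus the upper limit of the opposite sequence *)
  have -> : (fun w => limn_einf (fun n => ((D (t n) w) ^+ 2)%:E)) =
      (fun w => - limn_esup (fun n => - ((D (t n) w) ^+ 2)%:E))%E.
    by apply/funext => w; rewrite -[LHS]oppeK -limn_esupN.
  apply: measurableT_comp => //.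
  apply: (measurable_fun_limn_esup (f := fun n w => - ((D (t n) w) ^+ 2)%:E)%E) => n.
  exact: measurableT_comp.
apply: (@le_trans _ _ (limn_einf (fun n => \int[P]_w ((D (t n) w) ^+ 2)%:E)%E)).
  apply: le_trans (fatou P measurableT mt _); last first.
    by move=> n w _; rewrite lee_fin sqr_ge0.
  rewrite le_eqVlt; apply/orP; left; apply/eqP.
  apply: ae_eq_integral => //.
    by apply/measurable_EFinP; exact: measurable_funX.
  apply: filterS X_rc => w rc _ /=.
  rewrite (cvg_limn_einf_sup (l := ((D h w) ^+ 2)%:E))//.
  apply: cvg_EFin; first exact: nearW.
  have Dt : D (t n) w @[n --> \oo] --> D h w.
    by apply: cvgB; [exact: (cvg_comp _ _ tr (rc h))|exact: cvg_cst].
  by under eq_fun do rewrite /= expr2; rewrite expr2; exact: cvgM.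
have -> : (fun n => \int[P]_w ((D (t n) w) ^+ 2)%:E)%E =
    (fun n => (t n * g 1)%:E).
  apply/funext => n; rewrite integral_sqr; last by apply: sD; exact: lt_trans (ht n).
  by rewrite -/(g _) g_rat.
rewrite (cvg_limn_einf_sup (l := (h * g 1)%:E))//.
apply: cvg_EFin; first exact: nearW.
by apply: cvgM => //; exact: cvg_cst.
Qed.

(** The upper bounds [g_le] at h and N - h add up to the exact value of g at the
    integer N, up to the term 2 m(h)^2; this leaves no room for a nonzero mean
    nor for a strict inequality. *)
Lemma scalar_increment s t : s < t ->
  [/\ sqint P (fun w => X t w - X s w),
      mean P (fun w => X t w - X s w) = 0 &
      ip P (fun w => X t w - X s w) (fun w => X t w - X s w) = (t - s) * g 1].
Proof.
move=> st; set h := t - s; have h0 : 0 < h by rewrite subr_gt0.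
have mg : m h = 0 /\ g h = h * g 1.
  pose N := (Num.trunc h).+1; have hN : h < N%:R by exact: truncnS_gt.
  have h0' : 0 < N%:R - h by rewrite subr_gt0.
  have [_] := D_add h0 h0' (sD h0) (sD h0').
  rewrite (addrC h) subrK.
  have -> : (N%:R : R) = N%:R / 1%:R by rewrite divr1.
  rewrite m_rat g_rat divr1 => me ge.
  have := g_le h0; have := g_le h0'.
  have m0 : m h * m h = m h ^+ 2 by rewrite expr2.
  have mN : m (N%:R - h) = - m h by lra.
  rewrite mN in ge => l1 l2.
  have : m h ^+ 2 <= 0 by lra.
  rewrite real_exprn_even_le0//= => /eqP mh; split=> //.
  by rewrite mh in ge; lra.
have := lawN s h0; rewrite /h subrK => /eqlaw_sqint /(_ (sD h0)).
by case: mg => mh gh [] // ? ? ?; split=> //; rewrite -?mh -?gh.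
Qed.

End ScalarIncrements.

(** * Covariances of the increments of the vector process *)
Section VectorIncrements.
Context {disp : measure_display} {Omega : measurableType disp} {R : realType}.
Variable P : probability Omega R.
Variables (m : nat) (L : R -> Omega -> 'cV[R]_m).
Hypothesis hL : two_sided_levy P L.
Hypothesis hL2 : ('E_P[fun w => (\sum_i (L 1 w i ord0) ^+ 2)%R] < +oo)%E.
Hypothesis hL1 : forall i, ('E_P[fun w => (L 1 w i ord0)%R] = 0)%E.

Implicit Types i j : 'I_m.

(** Linear functionals that see two coordinates at most: enough to recover the
    covariance of two coordinates from variances, by polarization. *)
Definition coord_comb i j (a b : R) (x : 'cV[R]_m) : R :=
  a * x i ord0 + b * x j ord0.

Lemma coord_comb_continuous i j a b : continuous (coord_comb i j a b).
Proof.
move=> x; pose y k (z : 'cV[R]_m) := z k ord0.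
have c k : y k z @[z --> x] --> y k x by exact: coord_continuous.
exact: cvgD (cvgMl_tmp (c i)) (cvgMl_tmp (c j)).
Qed.

Lemma borel_coord_comb i j a b (E : set R) : measurable E ->
  borel_cV (coord_comb i j a b @^-1` E).
Proof.
pose phi : g_sigma_algebraType (@open 'cV[R]_m) -> R := coord_comb i j a b.
have mphi : measurable_fun setT phi.
  apply: (measurability _ (RGenOInfty.measurableE R)) => _ [_ [x ->] <-].
  rewrite setTI; apply: sub_sigma_algebra.
  have /continuousP := @coord_comb_continuous i j a b; apply; exact: interval_open.
by move=> mE; have := mphi measurableT E mE; rewrite setTI.
Qed.

Lemma coord_combB i j a b x y :
  coord_comb i j a b (x - y) = coord_comb i j a b x - coord_comb i j a b y.
Proof. by rewrite /coord_comb !mxE; ring. Qed.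

Let V i j a b t w := coord_comb i j a b (L t w).

Let mV i j a b t : measurable_fun setT (V i j a b t).
Proof.
move=> _ E mE; rewrite setTI.
have [rv _ _ _ _] := hL.
by apply: (rv t (coord_comb i j a b @^-1` E)); exact: borel_coord_comb.
Qed.

Let V_preimage i j a b s t E :
  (L t \- L s) @^-1` (coord_comb i j a b @^-1` E) =
  (fun w => V i j a b t w - V i j a b s w) @^-1` E.
Proof. by apply/seteqP; split=> w; rewrite /preimage /= coord_combB. Qed.

Let V_stat i j a b s t h : s < t ->
  eqlaw P (fun w => V i j a b (t + h) w - V i j a b (s + h) w)
          (fun w => V i j a b t w - V i j a b s w).
Proof.
move=> st E mE; have [_ _ stat _ _] := hL.
by have := stat s t h _ st (borel_coord_comb i j a b mE); rewrite !V_preimage.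
Qed.

Let V_indep i j a b i' j' a' b' s t u : s < t -> t < u ->
  indep P (fun w => V i j a b t w - V i j a b s w)
          (fun w => V i' j' a' b' u w - V i' j' a' b' t w).
Proof.
move=> st tu E E' mE mE'; have [_ _ _ ind _] := hL.
pose tt k := nth u [:: s; t] k.
pose B k := if k is 0%N then coord_comb i j a b @^-1` E else coord_comb i' j' a' b' @^-1` E'.
have htt k : (k < 2)%N -> tt k < tt k.+1 by case: k => [|[|]].
have hB k : (k < 2)%N -> borel_cV (B k).
  by case: k => [|[|]]//= _; exact: borel_coord_comb.
have := ind 2%N tt B htt hB.
rewrite !big_ord_recr big_ord0 /= mul1r.
have -> : \bigcap_(k in `I_2) ((L (tt k.+1) \- L (tt k)) @^-1` B k) =
   ((fun w => V i j a b t w - V i j a b s w) @^-1` E) `&`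
   ((fun w => V i' j' a' b' u w - V i' j' a' b' t w) @^-1` E').
  rewrite -!V_preimage; apply/seteqP; split=> w /=.
    by move=> hw; split; [exact: (hw 0%N)|exact: (hw 1%N)].
  by move=> [w0 w1] [|[|]].
rewrite /tt /= !V_preimage => h; have {h} := congr1 (fun x => x%:E) h.
rewrite EFinM !fineK//.
- by apply: fin_num_measure; rewrite -[X in measurable X]setTI; apply: measurable_funB.
- by apply: fin_num_measure; rewrite -[X in measurable X]setTI; apply: measurable_funB.
- apply: fin_num_measure; apply: measurableI;
   by rewrite -[X in measurable X]setTI; apply: measurable_funB.
Qed.

Let V_rc i j a b : {ae P, forall w, forall t, V i j a b u w @[u --> t^'+] --> V i j a b t w}.
Proof.
have [_ _ _ _] := hL; apply: filterS => w cad t.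
have [rc _] := cad t.
exact: cvg_comp rc (@coord_comb_continuous i j a b (L t w)).
Qed.

Let coord i t w := L t w i ord0.

Let mcoord i t : measurable_fun setT (coord i t).
Proof.
have := mV i i 1 0 t; congr measurable_fun.
by apply/funext => w; rewrite /V /coord_comb mul1r mul0r addr0.
Qed.

Let s_coord i : sqint P (coord i 1).
Proof.
apply: sqint_fin => //; apply: le_lt_trans hL2; rewrite unlock.
apply: ge0_le_integral => //=.
- by move=> w _; rewrite lee_fin sqr_ge0.
- by apply/measurable_EFinP; apply: measurable_funX.
- apply/measurable_EFinP; apply: measurable_sum => k.
  exact: measurable_funX (mcoord k 1).
- move=> w _; rewrite lee_fin (bigD1 i)//= lerDl sumr_ge0// => k _.
  exact: sqr_ge0.
Qed.

Let mean_coord i : mean P (coord i 1) = 0.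
Proof.
rewrite /mean /ip; under eq_Rintegral do rewrite mulr1.
by rewrite /Rintegral; have := hL1 i; rewrite unlock => ->.
Qed.

(** This is where L(0) = 0 enters: it turns the moments of L(1) into those of
    the increment L(1) - L(0). *)
Let L0 : {ae P, forall w, L 0 w = 0}.
Proof. by case: hL. Qed.

Let DV_ae i j a b : {ae P, forall w,
  (a * coord i 1 w + b * coord j 1 w) = V i j a b 1 w - V i j a b 0 w}.
Proof.
apply: filterS L0 => w; rewrite /V /coord_comb => ->; rewrite !mxE /coord; ring.
Qed.

Let s_V1 i j a b : sqint P (fun w => V i j a b 1 w - V i j a b 0 w).
Proof.
apply: (sqint_ae (X := fun w => a * coord i 1 w + b * coord j 1 w)) (DV_ae i j a b) _.
  exact: measurable_funB.
by apply: sqintD; exact: sqintZ.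
Qed.

Let mean_V1 i j a b : mean P (fun w => V i j a b 1 w - V i j a b 0 w) = 0.
Proof.
have s1 := sqint_cst P 1.
rewrite /mean -(ip_ae (X := fun w => a * coord i 1 w + b * coord j 1 w) (Y := fun=> 1))//.
- rewrite ipDl// ?ipZl// -?/(mean _ _); try exact: sqintZ.
  by rewrite !mean_coord !mulr0 addr0.
- by apply: measurable_funD; apply: measurable_funM.
- exact: measurable_funB.
- exact: nearW.
Qed.

Definition increment i (s t : R) (w : Omega) : R := L t w i ord0 - L s w i ord0.

Lemma incrementE i j s t : increment i s t = fun w => V i j 1 0 t w - V i j 1 0 s w.
Proof. by apply/funext => w; rewrite /V /coord_comb !mul1r !mul0r !addr0. Qed.

Lemma incrementE' i j s t : increment j s t = fun w => V i j 0 1 t w - V i j 0 1 s w.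
Proof. by apply/funext => w; rewrite /V /coord_comb !mul1r !mul0r !add0r. Qed.

Definition sigma i j : R := ip P (coord i 1) (coord j 1).

Let mincrement i s t : measurable_fun setT (increment i s t).
Proof. exact: measurable_funB (mcoord i t) (mcoord i s). Qed.

(** Polarization: 2 E(XY) is E(X + Y)^2 - E X^2 - E Y^2, and [scalar_increment]
    applies to both coordinates and to their sum. *)
Lemma increment_same i j s t : s < t ->
  [/\ sqint P (increment i s t), mean P (increment i s t) = 0 &
      ip P (increment i s t) (increment j s t) = (t - s) * sigma i j].
Proof.
move=> st.
have H a b := @scalar_increment _ _ _ P (V i j a b) (mV i j a b)
  (@V_stat i j a b) (@V_indep i j a b i j a b) (V_rc i j a b) (s_V1 i j a b)
  (mean_V1 i j a b) s t st.
have [si mi qi] := H 1 0; have [sj _ qj] := H 0 1; have [_ _ qij] := H 1 1.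
rewrite -incrementE -?incrementE' in si mi qi sj qj.
have E u v : (fun w => V i j 1 1 v w - V i j 1 1 u w) =
    (fun w => increment i u v w + increment j u v w).
  by apply/funext => w; rewrite /V /coord_comb /increment; ring.
have s01 k : sqint P (increment k 0 1) by rewrite (incrementE k k); exact: s_V1.
rewrite !E (ip_sqrD si sj) (ip_sqrD (s01 i) (s01 j)) in qij.
split=> //.
have -> : sigma i j = ip P (increment i 0 1) (increment j 0 1).
  apply: ip_ae => //.
  - by apply: filterS L0 => w; rewrite /increment => ->; rewrite mxE subr0.
  - by apply: filterS L0 => w; rewrite /increment => ->; rewrite mxE subr0.
rewrite -!incrementE -?incrementE' in qi qj; lra.
Qed.

Lemma increment_adjacent i j s t u : s < t -> t < u -> ip P (increment i s t) (increment j t u) = 0.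
Proof.
move=> st tu.
have [si mi _] := increment_same i j st; have [sj mj _] := increment_same j i tu.
rewrite indep_ip// ?mi ?mul0r//.
by rewrite (incrementE i i) (incrementE j j); exact: V_indep.
Qed.

Lemma sqint_increment_le i s t : s <= t -> sqint P (increment i s t) /\ mean P (increment i s t) = 0.
Proof.
rewrite le_eqVlt => /predU1P[->|/(increment_same i i)[]//].
have -> : increment i t t = fun=> 0 by apply/funext => w; rewrite /increment subrr.
by split; [exact: sqint0|exact: ip0l].
Qed.

(** With a common left end, the part of the longer increment beyond the shorter
    one is independent of the latter and does not contribute. *)
Lemma increment_base i j c s t : c <= s -> c <= t ->
  ip P (increment i c s) (increment j c t) = (Num.min s t - c) * sigma i j.
Proof.
have incrementcc k : increment k c c = fun=> 0 by apply/funext => w; rewrite /increment subrr.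
rewrite le_eqVlt => /predU1P[<- ct|cs].
  by rewrite incrementcc ip0l min_l// subrr mul0r.
rewrite le_eqVlt => /predU1P[<-|ct].
  by rewrite incrementcc ipC ip0l min_r ?ltW// subrr mul0r.
have [si mi e] := increment_same i j cs; have [sj mj e'] := increment_same j i ct.
have [st|ts|st] := ltrgtP s t.
- have -> : increment j c t = fun w => increment j c s w + increment j s t w.
    by apply/funext => w; rewrite /increment; ring.
  have [s1 _ _] := increment_same j j cs; have [s2 _ _] := increment_same j j st.
  by rewrite ipDr// e increment_adjacent// addr0.
- have -> : increment i c s = fun w => increment i c t w + increment i t s w.
    by apply/funext => w; rewrite /increment; ring.
  have [s1 _ e1] := increment_same i j ct; have [s2 _ _] := increment_same i i ts.
  by rewrite ipDl// e1 (ipC _ (increment i t s)) increment_adjacent// addr0.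
- by rewrite -st e.
Qed.

(** For a <= b and a' <= b' the combination of minima is the length of the
    intersection of ]a, b] and ]a', b'], see [ip_step01].  Both increments are
    differences of increments that start at the common point min a a'. *)
Lemma increment_cov i j a b a' b' : a <= b -> a' <= b' ->
  ip P (increment i a b) (increment j a' b') =
  (Num.min b b' - Num.min b a' - Num.min a b' + Num.min a a') * sigma i j.
Proof.
move=> ab ab'; set c := Num.min a a'.
have ca : c <= a by rewrite ge_min lexx.
have ca' : c <= a' by rewrite ge_min lexx orbT.
have cb := le_trans ca ab; have cb' := le_trans ca' ab'.
have E k s t : increment k s t = fun w => increment k c t w - increment k c s w.
  by apply/funext => w; rewrite /increment; ring.
have S k u : c <= u -> sqint P (increment k c u) by move=> /(sqint_increment_le k)[].
have sB := sqintB (S j _ cb') (S j _ ca').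
rewrite (E i a b) (E j a' b') (ipBl (S i _ cb) (S i _ ca) sB).
rewrite !(ipBr (S j _ cb') (S j _ ca'))//; try exact: S.
by rewrite !increment_base// -/c; ring.
Qed.

Lemma sigmaE i j : cov_matrix P (L 1) i j = sigma i j.
Proof.
rewrite mxE unlock /sigma /ip /Rintegral !hL1/= unlock; congr fine.
apply: eq_integral => w _  /=.
by rewrite [LHS](_ : _ = ((coord i 1 w - 0) * (coord j 1 w - 0))%:E)// !subr0.
Qed.

End VectorIncrements.

(** * Complex-valued functions through their real and imaginary parts *)

(** The imaginary part for [true], the real part for [false]: one index for the
    two real functions that make up a complex one. *)
Definition part {R : realType} (b : bool) (z : R[i]) : R :=
  if b then complex.Im z else complex.Re z.
Arguments part : simpl never.

Section ComplexParts.
Context {R : realType}.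

Lemma partD b (x y : R[i]) : part b (x + y) = part b x + part b y.
Proof. by case: b x y => -[? ?] [? ?]. Qed.

Lemma partB b (x y : R[i]) : part b (x - y) = part b x - part b y.
Proof. by case: b x y => -[? ?] [? ?]. Qed.

Lemma part0 b : part b (0 : R[i]) = 0.
Proof. by case: b. Qed.

Lemma part_sum b (I : Type) (s : seq I) (P : pred I) (F : I -> R[i]) :
  part b (\sum_(i <- s | P i) F i) = \sum_(i <- s | P i) part b (F i).
Proof. by apply: (big_morph (part b)); [exact: partD|exact: part0]. Qed.

Lemma partMr b (z : R[i]) (r : R) : part b (z * r%:C%C) = part b z * r.
Proof. by case: b; case: z => a c; rewrite /part; simpc. Qed.

Lemma partM b (x y : R[i]) : part b (x * y) =
  if b then part false x * part true y + part true x * part false y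
  else part false x * part false y - part true x * part true y.
Proof. by case: b x y => -[? ?] [? ?]. Qed.

Lemma part_conj b (x : R[i]) : part b x^* = (-1) ^+ b * part b x.
Proof. by case: b x => -[? ?]; rewrite /part /= ?expr0 ?expr1 ?mul1r ?mulN1r. Qed.

Lemma part_inj (x y : R[i]) : (forall b, part b x = part b y) -> x = y.
Proof. by case: x y => [a b] [c d] h; move: (h true) (h false); rewrite /part /= => -> ->. Qed.

End ComplexParts.

Section ComplexSquareIntegrable.
Context {disp : measure_display} {T : measurableType disp} {R : realType}.
Variable mu : {measure set T -> \bar R}.
Implicit Types h k : T -> R[i].

Definition sqint_c h : Prop := forall b, sqint mu (fun x => part b (h x)).

Definition int_c (D : set T) h : Prop :=
  forall b, mu.-integrable D (EFin \o (fun x => part b (h x))%R).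

Definition cint (D : set T) h : R[i] :=
  ((\int[mu]_(x in D) complex.Re (h x)) +i* (\int[mu]_(x in D) complex.Im (h x)))%C.

Lemma part_cint b D h : part b (cint D h) = \int[mu]_(x in D) part b (h x).
Proof. by case: b. Qed.

Lemma int_cM h k : sqint_c h -> sqint_c k -> int_c setT (fun x => h x * (k x)^*).
Proof.
move=> sh sk b.
have i b1 b2 := integrable_sqintM (sh b1) (sk b2).
case: b.
  rewrite (_ : _ \o _ = ((EFin \o (fun x => part true (h x) * part false (k x))%R)
    \- (EFin \o (fun x => part false (h x) * part true (k x))%R))%E); last first.
    apply/funext => x /=; congr EFin; rewrite (partM true) !part_conj /=; ring.
  exact: integrableB.
rewrite (_ : _ \o _ = ((EFin \o (fun x => part false (h x) * part false (k x))%R)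
    \+ (EFin \o (fun x => part true (h x) * part true (k x))%R))%E); last first.
  apply/funext => x /=; congr EFin; rewrite (partM false) !part_conj /=; ring.
exact: integrableD.
Qed.

Lemma part_cintM b h k : sqint_c h -> sqint_c k ->
  part b (cint setT (fun x => h x * (k x)^*)) =
  if b then ip mu (fun x => part true (h x)) (fun x => part false (k x)) -
            ip mu (fun x => part false (h x)) (fun x => part true (k x))
  else ip mu (fun x => part false (h x)) (fun x => part false (k x)) +
       ip mu (fun x => part true (h x)) (fun x => part true (k x)).
Proof.
move=> sh sk; rewrite part_cint /ip.
have i b1 b2 := integrable_sqintM (sh b1) (sk b2).
case: b.
  rewrite -RintegralB//; apply: eq_Rintegral => x _.
  by rewrite (partM true) !part_conj; ring.
rewrite -RintegralD//; apply: eq_Rintegral => x _.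
by rewrite (partM false) !part_conj; ring.
Qed.

Lemma int_cD D h k : measurable D -> int_c D h -> int_c D k ->
  int_c D (fun x => h x + k x).
Proof.
move=> mD ih ik b.
rewrite (_ : _ \o _ = ((EFin \o (fun x => part b (h x))%R) \+ (EFin \o (fun x => part b (k x))%R))%E).
  exact: integrableD.
by apply/funext => x /=; rewrite partD.
Qed.

Lemma cintD D h k : measurable D -> int_c D h -> int_c D k ->
  cint D (fun x => h x + k x) = cint D h + cint D k.
Proof.
move=> mD ih ik; apply: part_inj => b; rewrite partD !part_cint -RintegralD//.
by apply: eq_Rintegral => x _; rewrite partD.
Qed.

Lemma int_c0 D : int_c D (fun=> 0).
Proof.
move=> b; rewrite (_ : _ \o _ = cst 0%E); first exact: integrable0.
by apply/funext => x /=; rewrite part0.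
Qed.

Lemma cint0 D : cint D (fun=> 0) = 0.
Proof.
apply: part_inj => b; rewrite part_cint part0 /Rintegral.
by rewrite integral0.
Qed.

Lemma int_c_sum D (I : Type) (s : seq I) (P : pred I) (F : I -> T -> R[i]) :
  measurable D -> (forall i, int_c D (F i)) ->
  int_c D (fun x => \sum_(i <- s | P i) F i x).
Proof.
move=> mD iF; elim: s => [|i s ih].
  by under eq_fun do rewrite big_nil; exact: int_c0.
under eq_fun do rewrite big_cons; case: (P i) => //; exact: int_cD.
Qed.

Lemma cint_sum D (I : Type) (s : seq I) (P : pred I) (F : I -> T -> R[i]) :
  measurable D -> (forall i, int_c D (F i)) ->
  cint D (fun x => \sum_(i <- s | P i) F i x) = \sum_(i <- s | P i) cint D (F i).
Proof.
move=> mD iF; elim: s => [|i s ih].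
  by under eq_fun do rewrite big_nil; rewrite big_nil cint0.
under eq_fun do rewrite big_cons; rewrite big_cons; case: (P i) => //.
by rewrite cintD ?ih//; exact: int_c_sum.
Qed.

Lemma int_cZ D h (c : R[i]) : measurable D -> int_c D h -> int_c D (fun x => c * h x).
Proof.
move=> mD ih b.
have iZ b1 (r : R) : mu.-integrable D (fun x => r%:E * (EFin \o (fun x => part b1 (h x))%R) x)%E.
  exact: integrableZl.
case: b.
  rewrite (_ : _ \o _ = ((fun x => (part false c)%:E * (EFin \o (fun x => part true (h x))%R) x)
    \+ (fun x => (part true c)%:E * (EFin \o (fun x => part false (h x))%R) x))%E).
    exact: integrableD.
  by apply/funext => x /=; rewrite (partM true).
rewrite (_ : _ \o _ = ((fun x => (part false c)%:E * (EFin \o (fun x => part false (h x))%R) x)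
    \- (fun x => (part true c)%:E * (EFin \o (fun x => part true (h x))%R) x))%E).
  exact: integrableB.
by apply/funext => x /=; rewrite (partM false).
Qed.

Lemma cintZ D h (c : R[i]) : measurable D -> int_c D h ->
  cint D (fun x => c * h x) = c * cint D h.
Proof.
move=> mD ih; apply: part_inj => b; rewrite partM !part_cint.
have iZ b1 (r : R) : mu.-integrable D (EFin \o (fun x => r * part b1 (h x))%R).
  rewrite (_ : _ \o _ = (fun x => r%:E * (EFin \o (fun x => part b1 (h x))%R) x)%E)//.
  exact: integrableZl.
rewrite -!RintegralZl//; case: b.
  by rewrite -RintegralD//; apply: eq_Rintegral => x _; rewrite (partM true).
by rewrite -RintegralB//; apply: eq_Rintegral => x _; rewrite (partM false).
Qed.

Lemma sqint_c_sum (I : Type) (s : seq I) (P : pred I) (F : I -> T -> R[i]) :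
  (forall i, sqint_c (F i)) -> sqint_c (fun x => \sum_(i <- s | P i) F i x).
Proof.
by move=> sF b; under eq_fun do rewrite part_sum; apply: sqint_sum => i; exact: sF.
Qed.

Lemma sqint_cZ h (c : R[i]) : sqint_c h -> sqint_c (fun x => c * h x).
Proof.
move=> sh; case; under eq_fun do rewrite partM.
  by apply: sqintD; exact: sqintZ.
by apply: sqintB; exact: sqintZ.
Qed.

Lemma sqint_cZr h (c : R[i]) : sqint_c h -> sqint_c (fun x => h x * c).
Proof. by under eq_fun do rewrite mulrC; exact: sqint_cZ. Qed.

Lemma measurable_mx_part (a b : nat) (f : T -> 'M[R[i]]_(a, b)) : measurable_mx f ->
  forall i j e, measurable_fun setT (fun x => part e (f x i j)).
Proof. by move=> mf i j; case; have [] := mf i j. Qed.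

Lemma sqnormcE (z : R[i]) : sqnormc z = part false z ^+ 2 + part true z ^+ 2.
Proof. by []. Qed.

Lemma part_le_sqnorm (a b : nat) (M : 'M[R[i]]_(a, b)) i j e :
  part e (M i j) ^+ 2 <= sqnorm_mx M.
Proof.
rewrite /sqnorm_mx (bigD1 i)//= (bigD1 j)//= -addrA.
have sq0 (z : R[i]) : 0 <= sqnormc z by rewrite addr_ge0 ?sqr_ge0.
have -> : part e (M i j) ^+ 2 = part e (M i j) ^+ 2 + 0 by rewrite addr0.
apply: lerD; first by rewrite sqnormcE; case: e; rewrite ?lerDl ?lerDr sqr_ge0.
by rewrite addr_ge0 ?sumr_ge0// => l _; rewrite sumr_ge0.
Qed.

(** The squared modulus of a part of an entry is dominated by the squared norm
    of the matrix, so L^2 convergence of matrices is L^2 convergence of all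
    parts of all entries. *)
Lemma sqint_mx_limit (a b : nat) (h : nat -> T -> 'M[R[i]]_(a, b)) f :
  (forall n i j, sqint_c (fun x => h n x i j)) -> measurable_mx f ->
  (\int[mu]_x (sqnorm_mx (h n x - f x))%:E @[n --> \oo] --> 0)%E ->
  forall i j, sqint_c (fun x => f x i j) /\
    forall e, let df n x := part e (h n x i j) - part e (f x i j) in
    ip mu (df n) (df n) @[n --> \oo] --> 0.
Proof.
move=> sh mf hf i j.
have mfe := measurable_mx_part mf.
have H e := @sqint_limit _ _ _ mu (fun n x => part e (h n x i j))
   (fun x => part e (f x i j)) (fun n => sh n i j e) (mfe i j e).
have C e : (\int[mu]_x ((part e (h n x i j) - part e (f x i j)) ^+ 2)%:E @[n --> \oo] --> 0)%E.
  have c0 : (fun=> 0%E : \bar R) @ \oo --> (0%E : \bar R) by exact: cvg_cst.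
  apply: squeeze_cvge c0 hf.
  have mhf n i' j' e' : measurable_fun setT (fun x => part e' (h n x i' j') - part e' (f x i' j')).
    by apply: measurable_funB => //; case: (sh n i' j' e').
  apply: nearW => n; apply/andP; split.
    by apply: integral_ge0 => x _; rewrite lee_fin sqr_ge0.
  apply: ge0_le_integral => //.
  - by move=> x _; rewrite lee_fin sqr_ge0.
  - by apply/measurable_EFinP; exact: measurable_funX.
  - apply/measurable_EFinP; apply: measurable_sum => i'; apply: measurable_sum => j'.
    rewrite (_ : (fun x => _) = fun x =>
      (part false (h n x i' j') - part false (f x i' j')) ^+ 2 +
      (part true (h n x i' j') - part true (f x i' j')) ^+ 2); last first.
      by apply/funext => x; rewrite sqnormcE !mxE !partB.
    by apply: measurable_funD; exact: measurable_funX.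
  - move=> x _; rewrite lee_fin (le_trans _ (part_le_sqnorm _ i j e))//.
    by rewrite !mxE partB.
by split=> [e|e]; have [] := H e (C e).
Qed.

End ComplexSquareIntegrable.

(** * The isometry for step functions *)
Section Isometry.
Context {disp : measure_display} {Omega : measurableType disp} {R : realType}.
Variable P : probability Omega R.
Variables (m : nat) (L : R -> Omega -> 'cV[R]_m).
Hypothesis hL : two_sided_levy P L.
Hypothesis hL2 : ('E_P[fun w => (\sum_i (L 1 w i ord0) ^+ 2)%R] < +oo)%E.
Hypothesis hL1 : forall i, ('E_P[fun w => (L 1 w i ord0)%R] = 0)%E.
Local Notation leb := (@lebesgue_measure R).
Local Notation sg := (sigma P L).
Local Notation increment := (increment L).

Definition step01 (a b u : R) : R := if a < u <= b then 1 else 0.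

Lemma step01E a b : step01 a b = \1_(`]a, b]%classic : set R).
Proof.
apply/funext => u; rewrite /step01 indicE.
by case: ifPn => h; [rewrite mem_set//= in_itv/= h | rewrite memNset//= in_itv/=; apply/negP].
Qed.

Lemma Rintegral_step01 a b : a <= b -> \int[leb]_u step01 a b u = b - a.
Proof.
move=> ab; rewrite step01E /Rintegral integral_indic// setIT.
rewrite [X in fine X](lebesgue_measure_itv `]a, b])/= lte_fin; case: ltrP => // ba.
by rewrite (le_anti (_ : a <= b <= a)) ?ab// subrr.
Qed.

Lemma Rintegral_step01_gt a b : b < a -> \int[leb]_u step01 a b u = 0.
Proof.
move=> ba; rewrite step01E /Rintegral integral_indic// setIT.
by rewrite [X in fine X](lebesgue_measure_itv `]a, b])/= lte_fin ltNge (ltW ba).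
Qed.

Lemma sqint_step01 a b : sqint leb (step01 a b).
Proof.
split; first by rewrite step01E; exact: measurable_indic.
rewrite (_ : _ \o _ = EFin \o step01 a b).
  rewrite step01E; exact: integrable_indic_itv.
by apply/funext => u /=; rewrite /step01; case: ifP; rewrite ?expr1n ?expr0n.
Qed.

Lemma ip_step01 a b a' b' : a <= b -> a' <= b' ->
  ip leb (step01 a b) (step01 a' b') =
  Num.min b b' - Num.min b a' - Num.min a b' + Num.min a a'.
Proof.
move=> ab ab'.
have -> : ip leb (step01 a b) (step01 a' b') =
    \int[leb]_u step01 (Num.max a a') (Num.min b b') u.
  apply: eq_Rintegral => u _; rewrite /step01 gt_max le_min.
  by case: (a < u); case: (a' < u); case: (u <= b); case: (u <= b'); rewrite /= ?mulr1 ?mulr0.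
have [h|h] := leP (Num.max a a') (Num.min b b').
  rewrite Rintegral_step01//; move: h.
  by rewrite !minElt !maxElt; do !case: ifPn; rewrite -?leNgt; lra.
rewrite Rintegral_step01_gt//; move: h.
by rewrite !minElt !maxElt; do !case: ifPn; rewrite -?leNgt; lra.
Qed.

Lemma increment_step i j a b a' b' : a <= b -> a' <= b' ->
  ip P (increment i a b) (increment j a' b') = ip leb (step01 a b) (step01 a' b') * sg i j.
Proof. by move=> ab ab'; rewrite ip_step01//; exact: increment_cov. Qed.

Lemma sqint_increment i s t : sqint P (increment i s t).
Proof.
have [st|ts] := leP s t; first by have [] := sqint_increment_le hL hL2 hL1 i st.
have [h _] := sqint_increment_le hL hL2 hL1 i (ltW ts).
rewrite (_ : increment i s t = fun w => (-1) * increment i t s w); first exact: sqintZ.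
by apply/funext => w; rewrite /increment; ring.
Qed.

Variable d : nat.
Local Notation steps := (seq (R * R * 'M[R[i]]_(d, m))).

Lemma part_step_value (s : steps) b u i k :
  part b (step_value s u i k) =
  \sum_(x <- s) part b (x.2 i k) * step01 x.1.1 x.1.2 u.
Proof.
rewrite /step_value summxE part_sum; apply: eq_bigr => x _.
by rewrite /step01; case: ifP; rewrite ?mulr1 ?mxE ?part0 ?mulr0.
Qed.

Lemma part_step_integral (s : steps) b w i :
  part b (step_integral L s w i ord0) =
  \sum_k \sum_(x <- s) part b (x.2 i k) * increment k x.1.1 x.1.2 w.
Proof.
rewrite /step_integral summxE part_sum exchange_big /=; apply: eq_bigr => x _.
by rewrite mxE part_sum; apply: eq_bigr => k _; rewrite !mxE partMr.
Qed.

Lemma sqint_step_value (s : steps) i k : sqint_c leb (fun u => step_value s u i k).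
Proof.
move=> b; under eq_fun do rewrite part_step_value.
by apply: sqint_sum => x; apply: sqintZ; exact: sqint_step01.
Qed.

Lemma sqint_step_integral (s : steps) i :
  sqint_c P (fun w => step_integral L s w i ord0).
Proof.
move=> b; under eq_fun do rewrite part_step_integral.
by apply: sqint_sum => k; apply: sqint_sum => x; apply: sqintZ; exact: sqint_increment.
Qed.

Definition increasing_steps (s : steps) : Prop := forall x, x \in s -> x.1.1 <= x.1.2.

Lemma mean_step_integral (s : steps) b i : increasing_steps s ->
  mean P (fun w => part b (step_integral L s w i ord0)) = 0.
Proof.
move=> hs; rewrite /mean; under eq_fun do rewrite part_step_integral.
have si k s' t' := sqint_increment k s' t'; have s1 := sqint_cst P 1.
have sx k (x : R * R * 'M[R[i]]_(d, m)) :=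
  sqintZ (part b (x.2 i k)) (si k x.1.1 x.1.2).
rewrite ip_suml//; last by move=> k; apply: sqint_sum => x; exact: sx.
rewrite big1// => k _; rewrite ip_suml//.
rewrite big_seq big1// => x /hs xs; rewrite ipZl//.
by have [_] := sqint_increment_le hL hL2 hL1 k xs; rewrite /mean => ->; rewrite mulr0.
Qed.

(** Both sides are bilinear in the two step functions; for single steps the
    identity is [increment_step]. *)
Lemma step_isometry (s s' : steps) b b' i j :
  increasing_steps s -> increasing_steps s' ->
  ip P (fun w => part b (step_integral L s w i ord0))
       (fun w => part b' (step_integral L s' w j ord0)) =
  \sum_k \sum_l sg k l * ip leb (fun u => part b (step_value s u i k))
                                (fun u => part b' (step_value s' u j l)).
Proof.
move=> hs hs'.
under eq_fun do rewrite part_step_integral.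
under [X in ip P _ X]eq_fun do rewrite part_step_integral.
have si k x1 x2 := sqint_increment k x1 x2.
have sx e i0 k (x : R * R * 'M[R[i]]_(d, m)) :=
  sqintZ (part e (x.2 i0 k)) (si k x.1.1 x.1.2).
have sS e i0 k t := @sqint_sum _ _ _ P _ t xpredT _ (sx e i0 k).
have ti := sqint_step01.
have tx e i0 k (x : R * R * 'M[R[i]]_(d, m)) :=
  sqintZ (part e (x.2 i0 k)) (ti x.1.1 x.1.2).
have tS e i0 k t := @sqint_sum _ _ _ leb _ t xpredT _ (tx e i0 k).
rewrite ip_suml//; last by apply: sqint_sum => k; exact: sS.
apply: eq_bigr => k _; rewrite ip_sumr//; apply: eq_bigr => l _.
under [X in _ = _ * ip leb X _]eq_fun do rewrite part_step_value.
under [X in _ = _ * ip leb _ X]eq_fun do rewrite part_step_value.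
rewrite ip_suml// ip_suml// mulr_sumr big_seq [RHS]big_seq; apply: eq_bigr => x /hs xs.
rewrite ip_sumr// ip_sumr// mulr_sumr big_seq [RHS]big_seq; apply: eq_bigr => y /hs' ys.
by rewrite !ipZl// !ipZr// increment_step//; ring.
Qed.

(** The square integrability of f and X comes with the approximation: they
    differ from a step function and its integral by functions of finite norm. *)
Lemma levy_integral_sqint (f : R -> 'M[R[i]]_(d, m)) X : levy_integral P L f X ->
  (forall i k, sqint_c leb (fun u => f u i k)) /\
  (forall i j, sqint_c P (fun w => X w i j)).
Proof.
move=> [mf mX [s [hs fs Xs]]].
have sX n i (j : 'I_1) : sqint_c P (fun w => step_integral L (s n) w i j).
  by rewrite (ord1 j); exact: sqint_step_integral.
split=> i k.
  by have [] := sqint_mx_limit (fun n => sqint_step_value (s n)) mf fs i k.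
by have [] := sqint_mx_limit sX mX Xs i k.
Qed.

End Isometry.

(** * The isometry for limits of step functions *)
Lemma cvg_sumr (K : numFieldType) (I : Type) (s : seq I) (F : I -> nat -> K) (l : I -> K) :
  (forall i, F i n @[n --> \oo] --> l i) ->
  \sum_(i <- s) F i n @[n --> \oo] --> \sum_(i <- s) l i.
Proof.
move=> Fl; elim: s => [|i s ih].
  by under eq_fun do rewrite big_nil; rewrite big_nil; exact: cvg_cst.
by under eq_fun do rewrite big_cons; rewrite big_cons; exact: cvgD.
Qed.

Section LevyIsometry.
Context {disp : measure_display} {Omega : measurableType disp} {R : realType}.
Variable P : probability Omega R.
Variables (m : nat) (L : R -> Omega -> 'cV[R]_m).
Hypothesis hL : two_sided_levy P L.
Hypothesis hL2 : ('E_P[fun w => (\sum_i (L 1 w i ord0) ^+ 2)%R] < +oo)%E.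
Hypothesis hL1 : forall i, ('E_P[fun w => (L 1 w i ord0)%R] = 0)%E.
Local Notation leb := (@lebesgue_measure R).
Local Notation sg := (sigma P L).
Variable d : nat.
Implicit Types (f g : R -> 'M[R[i]]_(d, m)) (X Z : Omega -> 'cV[R[i]]_d).

(** The step integrals are centred, and the mean is continuous in L^2. *)
Lemma levy_integral_mean f X b i : levy_integral P L f X ->
  mean P (fun w => part b (X w i ord0)) = 0.
Proof.
move=> fX; have [_ sX] := levy_integral_sqint hL hL2 hL1 fX.
have [mf mX [s [hs fs Xs]]] := fX.
have sS n k (j : 'I_1) : sqint_c P (fun w => step_integral L (s n) w k j).
  by rewrite (ord1 j); exact: sqint_step_integral.
have [_ c] := sqint_mx_limit sS mX Xs i ord0.
have s1 := sqint_cst P 1.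
have := ip_cvg (fun n => sS n i ord0 b) (fun=> s1) (sX i ord0 b) s1 (c b) _.
under [X in X @ _ --> _ -> _]eq_fun do under eq_fun do rewrite subrr.
under [X in X @ _ --> _ -> _]eq_fun do rewrite ip0l.
move=> /(_ (cvg_cst _)) /cvg_lim; rewrite /mean => <-//.
rewrite (_ : (fun n => _) = fun=> 0); first by rewrite lim_cst.
by apply/funext => n; apply: (mean_step_integral hL hL2 hL1); exact: hs.
Qed.

(** Both sides of [step_isometry] converge along the step approximations. *)
Lemma levy_isometry_part f g X Z b b' i j :
  levy_integral P L f X -> levy_integral P L g Z ->
  ip P (fun w => part b (X w i ord0)) (fun w => part b' (Z w j ord0)) =
  \sum_k \sum_l sg k l * ip leb (fun u => part b (f u i k))
                                (fun u => part b' (g u j l)).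
Proof.
move=> fX gZ.
have [sf sX] := levy_integral_sqint hL hL2 hL1 fX.
have [sg' sZ] := levy_integral_sqint hL hL2 hL1 gZ.
have [mf mX [s [hs fs Xs]]] := fX.
have [mg mZ [r [hr gr Zr]]] := gZ.
have sS (t : nat -> seq (R * R * 'M[R[i]]_(d, m))) n k (e : 'I_1) :
    sqint_c P (fun w => step_integral L (t n) w k e).
  by rewrite (ord1 e); exact: sqint_step_integral.
have [_ cX] := sqint_mx_limit (sS s) mX Xs i ord0.
have [_ cZ] := sqint_mx_limit (sS r) mZ Zr j ord0.
have cP := ip_cvg (fun n => sS s n i ord0 b) (fun n => sS r n j ord0 b')
  (sX i ord0 b) (sZ j ord0 b') (cX b) (cZ b').
have vs (t : nat -> seq (R * R * 'M[R[i]]_(d, m))) n := sqint_step_value (t n).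
have cL k l : ip leb (fun u => part b (step_value (s n) u i k))
     (fun u => part b' (step_value (r n) u j l)) @[n --> \oo] -->
   ip leb (fun u => part b (f u i k)) (fun u => part b' (g u j l)).
  have [_ cf] := sqint_mx_limit (vs s) mf fs i k.
  have [_ cg] := sqint_mx_limit (vs r) mg gr j l.
  exact: (ip_cvg (fun n => vs s n i k b) (fun n => vs r n j l b') (sf i k b) (sg' j l b')
    (cf b) (cg b')).
have cS : \sum_k \sum_l sg k l * ip leb (fun u => part b (step_value (s n) u i k))
     (fun u => part b' (step_value (r n) u j l)) @[n --> \oo] -->
   \sum_k \sum_l sg k l * ip leb (fun u => part b (f u i k)) (fun u => part b' (g u j l)).
  apply: cvg_sumr => k; apply: cvg_sumr => l.
  exact: cvgMl_tmp.
apply: cvg_unique cP _ => //.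
rewrite (_ : (fun n => ip P _ _) = fun n => \sum_k \sum_l sg k l *
  ip leb (fun u => part b (step_value (s n) u i k))
     (fun u => part b' (step_value (r n) u j l)))//.
apply/funext => n; apply: (step_isometry hL hL2 hL1); [exact: hs|exact: hr].
Qed.

(** The complex form, reassembled from the four combinations of real and
    imaginary parts of [levy_isometry_part]. *)
Lemma levy_isometry f g X Z :
  levy_integral P L f X -> levy_integral P L g Z ->
  integral_mx P setT (fun w => X w *m (Z w)^t*) =
  integral_mx leb setT (fun u => f u *m c_mx (cov_matrix P (L 1)) *m (g u)^t*).
Proof.
move=> fX gZ.
have [sf sX] := levy_integral_sqint hL hL2 hL1 fX.
have [sg' sZ] := levy_integral_sqint hL hL2 hL1 gZ.
apply/matrixP => i j; rewrite !mxE.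
transitivity (cint P setT (fun w => X w i ord0 * (Z w j ord0)^*)).
  by rewrite /cint; congr Complex; apply: eq_Rintegral => w _;
    rewrite mxE big_ord1 !mxE.
transitivity (cint leb setT (fun u => \sum_k \sum_l (sg k l)%:C%C * (f u i k * (g u j l)^*))); last first.
  rewrite /cint; congr Complex; apply: eq_Rintegral => u _; congr (_ _).
    rewrite mxE exchange_big /=; apply: eq_bigr => l _.
    rewrite !mxE mulr_suml; apply: eq_bigr => k _.
    by rewrite mxE (sigmaE hL1); ring.
  rewrite mxE exchange_big /=; apply: eq_bigr => l _.
  rewrite !mxE mulr_suml; apply: eq_bigr => k _.
  by rewrite mxE (sigmaE hL1); ring.
have ic k l : int_c leb setT (fun u => f u i k * (g u j l)^*) by exact: int_cM.
have icZ k l : int_c leb setT (fun u => (sg k l)%:C%C * (f u i k * (g u j l)^*)) by exact: int_cZ.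
have E : cint leb setT (fun u => \sum_k \sum_l (sg k l)%:C%C * (f u i k * (g u j l)^*)) =
   \sum_k \sum_l cint leb setT (fun u => f u i k * (g u j l)^*) * (sg k l)%:C%C.
  rewrite cint_sum//; last by move=> k; exact: int_c_sum.
  apply: eq_bigr => k _; rewrite cint_sum//; apply: eq_bigr => l _.
  by rewrite cintZ// mulrC.
rewrite E; apply: part_inj => b; rewrite part_cintM// part_sum.
under [RHS]eq_bigr do rewrite part_sum; under [RHS]eq_bigr do under eq_bigr do rewrite partMr part_cintM//.
rewrite !(levy_isometry_part _ _ _ _ fX gZ).
case: b.
  rewrite -sumrB; apply: eq_bigr => k _; rewrite -sumrB; apply: eq_bigr => l _; ring.
rewrite -big_split; apply: eq_bigr => k _; rewrite -big_split; apply: eq_bigr => l _ /=; ring.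
Qed.

End LevyIsometry.

(** * The matrix exponential *)
Section RealExponentialSums.
Context {R : realType}.

(** Used with x n a part of an entry of the power M^n, so that these are the
    real or imaginary parts of the entries of the partial sums of exp(s M), and
    with x n = c^n, which gives the partial sums of the real exp(s c). *)
Definition exp_sum (x : nat -> R) (s : R) (N : nat) : R :=
  \sum_(n < N) s ^+ n / n`!%:R * x n.

Definition exp_weight (s t : R) (k l : nat) : R :=
  s ^+ k / k`!%:R * (t ^+ l / l`!%:R).

(** By induction on N: passing from N to N + 1 adds the diagonal k + l = N. *)
Lemma sum_triangle (F : nat -> nat -> R) N :
  \sum_(n < N) \sum_(k < n.+1) F k (n - k)%N =
  \sum_(k < N) \sum_(l < N | (k + l < N)%N) F k l.
Proof.
have -> : \sum_(k < N) \sum_(l < N | (k + l < N)%N) F k l =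
    \sum_(k < N) \sum_(l < N - k) F k l.
  apply: eq_bigr => k _.
  rewrite (big_ord_widen N (F k)); last exact: leq_subr.
  by apply: eq_bigl => l; rewrite ltn_subRL.
elim: N => [|N ih]; first by rewrite !big_ord0.
rewrite big_ord_recr /= ih.
have -> : \sum_(k < N) \sum_(l < N - k) F k l = \sum_(k < N.+1) \sum_(l < N - k) F k l.
  by rewrite [RHS]big_ord_recr/= subnn big_ord0 addr0.
rewrite -big_split; apply: eq_bigr => k _ /=.
by rewrite subSn ?big_ord_recr//= -ltnS.
Qed.

(** The binomial theorem, with the terms indexed by (k, l) instead of
    (k + l, k). *)
Lemma exp_sumD (x : nat -> R) s t N : exp_sum x (s + t) N =
  \sum_(k < N) \sum_(l < N | (k + l < N)%N) exp_weight s t k l * x (k + l)%N.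
Proof.
rewrite -(sum_triangle (fun k l => exp_weight s t k l * x (k + l)%N)).
apply: eq_bigr => n _; rewrite addrC exprDn !mulr_suml; apply: eq_bigr => k _.
have kn : (k <= n)%N by rewrite -ltnS.
rewrite /exp_weight subnKC//; congr (_ * _).
have nz j : (j`!%:R : R) != 0 by rewrite pnatr_eq0 -lt0n fact_gt0.
rewrite -mulr_natr -(bin_fact kn) natrM natrM.
have bz : ('C(n, k)%:R : R) != 0 by rewrite pnatr_eq0 -lt0n bin_gt0.
by field; rewrite !nz bz.
Qed.

Lemma exp_sum_tail (x : nat -> R) s t N :
  \sum_(k < N) \sum_(l < N) exp_weight s t k l * x (k + l)%N - exp_sum x (s + t) N =
  \sum_(k < N) \sum_(l < N | (N <= k + l)%N) exp_weight s t k l * x (k + l)%N.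
Proof.
rewrite exp_sumD -sumrB; apply: eq_bigr => k _.
rewrite (bigID (fun l : 'I_N => (k + l < N)%N))/= addrAC subrr add0r.
by apply: eq_bigl => l; rewrite -leqNgt.
Qed.

Lemma exp_sum_cvg (c s : R) : exp_sum (fun n => c ^+ n) s N @[N --> \oo] --> expR (s * c).
Proof.
have -> : exp_sum (fun n => c ^+ n) s = series (exp_coeff (s * c)).
  apply/funext => N; rewrite /exp_sum /series/= big_mkord; apply: eq_bigr => n _.
  by rewrite /exp_coeff/= exprMn mulrAC.
exact: is_cvg_series_exp_coeff.
Qed.

Lemma exp_sum_is_cvg (x : nat -> R) (c s : R) : (forall n, `|x n| <= c ^+ n) ->
  cvgn (exp_sum x s).
Proof.
move=> xc.
have -> : exp_sum x s = series (fun n => s ^+ n / n`!%:R * x n).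
  by apply/funext => N; rewrite /exp_sum /series/= big_mkord.
apply: normed_cvg.
apply: (@series_le_cvg _ _ (exp_coeff (`|s| * c))) => [n|n|n|].
- exact: normr_ge0.
- by rewrite /exp_coeff/= exprMn !mulr_ge0// (le_trans _ (xc n)).
- rewrite /exp_coeff /= !normrM normrX normfV normr_nat exprMn mulrAC.
  by rewrite ler_wpM2r// ler_wpM2l.
- exact: is_cvg_series_exp_coeff.
Qed.

(** The defect between the product of two partial sums and the partial sum of
    the product is the sum over the corner k, l < N <= k + l.  It is dominated
    by the same defect for absolute values and x n = c^n, which tends to
    exp(|s|c) exp(|t|c) - exp((|s|+|t|)c) = 0.  The law of the real exponential
    thus takes the place of a theorem on Cauchy products. *)
Lemma exp_sum_tail_cvg (x : nat -> R) (c s t : R) : (forall n, `|x n| <= c ^+ n) ->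
  \sum_(k < N) \sum_(l < N) exp_weight s t k l * x (k + l)%N - exp_sum x (s + t) N
    @[N --> \oo] --> 0.
Proof.
move=> xc; apply/norm_cvg0P.
pose e (N : nat) := exp_sum (fun n => c ^+ n) `|s| N * exp_sum (fun n => c ^+ n) `|t| N -
  exp_sum (fun n => c ^+ n) (`|s| + `|t|) N.
have e0 : e N @[N --> \oo] --> 0.
  rewrite -[X in _ --> X](subrr (expR (`|s| * c) * expR (`|t| * c))).
  rewrite -[X in _ --> _ - X]expRD -mulrDl.
  by apply: cvgB; [apply: cvgM|]; exact: exp_sum_cvg.
apply: (@squeeze_cvgr _ _ _ _ (fun=> 0) e) => //; last exact: cvg_cst.
apply: nearW => N; rewrite normr_ge0/= exp_sum_tail.
have -> : e N = \sum_(k < N) \sum_(l < N | (N <= k + l)%N)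
    exp_weight `|s| `|t| k l * c ^+ (k + l)%N.
  rewrite -exp_sum_tail /e; congr (_ - _).
  rewrite /exp_sum mulr_suml; apply: eq_bigr => k _.
  rewrite mulr_sumr; apply: eq_bigr => l _; rewrite /exp_weight exprD; ring.
rewrite (le_trans (ler_norm_sum _ _ _))//; apply: ler_sum => k _.
rewrite (le_trans (ler_norm_sum _ _ _))//; apply: ler_sum => l _.
rewrite normrM ler_pM//.
by rewrite /exp_weight !normrM !normrX !normfV !normr_nat.
Qed.

End RealExponentialSums.

Section MatrixExponential.
Context {R : realType}.

Lemma part_norm_le b (z : R[i]) : `|part b z|%:C%C <= `|z|.
Proof.
case: b; last exact: normc_ge_Re.
have := normc_ge_Re (z * 'i%C); rewrite ReiNIm normrN normrM.
have -> : `|'i%C : R[i]| = 1 by rewrite normc_def/= expr0n expr1n add0r sqrtr1.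
by rewrite mulr1.
Qed.

Lemma norm_le_part (z : R[i]) : `|z| <= (`|part false z| + `|part true z|)%:C%C.
Proof.
rewrite {1}[z]complexE rmorphD/= (le_trans (ler_normD _ _))//.
have -> : `|'i%C * (complex.Im z)%:C%C : R[i]| = `|complex.Im z|%:C%C.
  by rewrite normc_def/=; simpc; rewrite /= expr0n/= add0r sqrtr_sqr.
by rewrite lerD// normc_def/= expr0n/= addr0 sqrtr_sqr.
Qed.

Lemma cvg_mx_part (a b : nat) (F : nat -> 'M[R[i]]_(a, b)) (G : 'M[R[i]]_(a, b)) :
  (forall e i j, part e (F n i j) @[n --> \oo] --> part e (G i j)) ->
  F n @[n --> \oo] --> G.
Proof.
move=> FG; apply/cvg_ballP => eps eps0.
have [r r0 er] : exists2 r : R, 0 < r & eps = r%:C%C.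
  move: eps0; case: eps => r y; rewrite ltcE/= => /andP[/eqP y0 r0].
  by exists r => //; rewrite y0.
have H : \forall n \near \oo, forall ij : 'I_a * 'I_b,
    `|part false (G ij.1 ij.2) - part false (F n ij.1 ij.2)| < r / 2 /\
    `|part true (G ij.1 ij.2) - part true (F n ij.1 ij.2)| < r / 2.
  apply: filter_forall => ij.
  have r20 : 0 < r / 2 by rewrite divr_gt0.
  have /cvgr_dist_lt/(_ _ r20) h0 := FG false ij.1 ij.2.
  have /cvgr_dist_lt/(_ _ r20) h1 := FG true ij.1 ij.2.
  by apply: filterS2 h0 h1.
apply: filterS H => n H; split=> // i j.
have [h1 h2] := H (i, j).
rewrite -ball_normE/= er (le_lt_trans (norm_le_part _))// ltcR !partB.
by rewrite [ltRHS]splitr ltrD.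
Qed.

Variable d : nat.
Implicit Types M : 'M[R[i]]_d.

Lemma mx_exprZn M (a : R[i]) n : (a *: M) ^+ n = a ^+ n *: M ^+ n.
Proof.
elim: n => [|n ih]; first by rewrite !expr0 scale1r.
rewrite !exprS ih; change ((a *: M) *m (a ^+ n *: M ^+ n) = (a * a ^+ n) *: (M *m M ^+ n)).
by rewrite -scalemxAl -scalemxAr scalerA.
Qed.

(** With C the sum of the moduli of the entries of M, the entries of M^n are
    bounded by C^n. *)
Lemma part_expmx_bound M : exists c : R, forall b n i j, `|part b ((M ^+ n) i j)| <= c ^+ n.
Proof.
pose C : R[i] := \sum_i \sum_j `|M i j|.
have C0 : 0 <= C by apply: sumr_ge0 => i _; apply: sumr_ge0.
have H n i j : `|(M ^+ n) i j| <= C ^+ n.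
  elim: n i j => [|n ih] i j.
    by rewrite !expr0 mxE; case: (i == j); rewrite ?normr1 ?normr0 ?ler01.
  rewrite !exprSr mxE (le_trans (ler_norm_sum _ _ _))//.
  have : \sum_k `|M k j| <= C.
    by apply: ler_sum => k _; rewrite (bigD1 j)//= lerDl sumr_ge0.
  move=> h; rewrite (le_trans _ (ler_wpM2l (exprn_ge0 _ C0) h))// mulr_sumr.
  by apply: ler_sum => k _; rewrite normrM ler_wpM2r.
have CE : C = (complex.Re C)%:C%C by rewrite RRe_real// ger0_real.
exists (complex.Re C) => b n i j; rewrite -lecR (le_trans (part_norm_le _ _))//.
by rewrite rmorphXn/= -CE.
Qed.

(** The series converges because, for each part of each entry, it is dominated
    by the series of exp(|s|c), with c from [part_expmx_bound]. *)
Lemma part_expmx M (s : R) b i j :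
  exp_sum (fun n => part b ((M ^+ n) i j)) s N @[N --> \oo] -->
  part b (expmx (s%:C%C *: M) i j).
Proof.
have [c hc] := part_expmx_bound M.
have cv e k l : cvgn (exp_sum (fun n => part e ((M ^+ n) k l)) s).
  by apply: (@exp_sum_is_cvg _ _ c) => n.
pose E : 'M[R[i]]_d := \matrix_(k, l)
  (limn (exp_sum (fun n => part false ((M ^+ n) k l)) s) +i*
   limn (exp_sum (fun n => part true ((M ^+ n) k l)) s))%C.
have pE e k l : part e (E k l) = limn (exp_sum (fun n => part e ((M ^+ n) k l)) s).
  by rewrite mxE; case: e.
suff -> : expmx (s%:C%C *: M) = E by rewrite pE; exact: cv.
rewrite /expmx; apply: cvg_lim; first exact: norm_hausdorff.
apply: cvg_mx_part => e k l; rewrite pE.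
rewrite (_ : (fun n => _) = exp_sum (fun n => part e ((M ^+ n) k l)) s).
  exact: cv.
apply/funext => N; rewrite /series/= big_mkord summxE part_sum.
apply: eq_bigr => n _; rewrite mx_exprZn !mxE.
have -> : (n`!%:R^-1 : R[i]) = (n`!%:R^-1)%:C%C by rewrite fmorphV rmorph_nat.
rewrite -rmorphXn/= mulrA -rmorphM/= mulrC partMr; ring.
Qed.

(** Entrywise, the product of the two partial sums is the double sum over
    k, l < N of [exp_weight] times M^(k+l), so [exp_sum_tail_cvg] applies. *)
Lemma expmxD M (s t : R) :
  expmx ((s + t)%:C%C *: M) = expmx (s%:C%C *: M) *m expmx (t%:C%C *: M).
Proof.
apply/matrixP => i j; apply: part_inj => b.
have [c hc] := part_expmx_bound M.
pose x n := part b ((M ^+ n) i j).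
have T := exp_sum_tail_cvg s t (hc b ^~ i ^~ j).
have pS := @part_expmx M s; have pT := @part_expmx M t.
have prod : \sum_(k < N) \sum_(l < N) exp_weight s t k l * x (k + l)%N @[N --> \oo] -->
    part b ((expmx (s%:C%C *: M) *m expmx (t%:C%C *: M)) i j).
  rewrite mxE part_sum.
  have -> : (fun N : nat => \sum_(k < N) \sum_(l < N) exp_weight s t k l * x (k + l)%N) =
    fun N => \sum_r (if b then
      exp_sum (fun n => part false ((M ^+ n) i r)) s N * exp_sum (fun n => part true ((M ^+ n) r j)) t N +
      exp_sum (fun n => part true ((M ^+ n) i r)) s N * exp_sum (fun n => part false ((M ^+ n) r j)) t N
      else exp_sum (fun n => part false ((M ^+ n) i r)) s N * exp_sum (fun n => part false ((M ^+ n) r j)) t N -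
      exp_sum (fun n => part true ((M ^+ n) i r)) s N * exp_sum (fun n => part true ((M ^+ n) r j)) t N).
    apply/funext => N.
    have ee e e' r : exp_sum (fun n => part e ((M ^+ n) i r)) s N *
        exp_sum (fun n => part e' ((M ^+ n) r j)) t N =
        \sum_(k < N) \sum_(l < N) exp_weight s t k l *
          (part e ((M ^+ k) i r) * part e' ((M ^+ l) r j)).
      rewrite /exp_sum mulr_suml; apply: eq_bigr => k _.
      by rewrite mulr_sumr; apply: eq_bigr => l _; rewrite /exp_weight; ring.
    under [RHS]eq_bigr do rewrite !ee.
    rewrite /x; case: b {x T}.
      under [RHS]eq_bigr do rewrite -big_split.
      rewrite [RHS]exchange_big; apply: eq_bigr => k _.
      under [RHS]eq_bigr do rewrite -big_split.
      rewrite [RHS]exchange_big; apply: eq_bigr => l _ /=.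
      rewrite exprD mxE part_sum mulr_sumr; apply: eq_bigr => r _.
      by rewrite (partM true) mulrDr.
    under [RHS]eq_bigr do rewrite -sumrB.
    rewrite [RHS]exchange_big; apply: eq_bigr => k _.
    under [RHS]eq_bigr do rewrite -sumrB.
    rewrite [RHS]exchange_big; apply: eq_bigr => l _ /=.
    rewrite exprD mxE part_sum mulr_sumr; apply: eq_bigr => r _.
    by rewrite (partM false) mulrBr.
  apply: cvg_sumr => r; rewrite partM; case: b {x T}.
    by apply: cvgD; apply: cvgM.
  by apply: cvgB; apply: cvgM.
apply: cvg_unique (@part_expmx M (s + t) b i j) _ => //.
have -> : exp_sum x (s + t) = fun N =>
    \sum_(k < N) \sum_(l < N) exp_weight s t k l * x (k + l)%N -
    (\sum_(k < N) \sum_(l < N) exp_weight s t k l * x (k + l)%N - exp_sum x (s + t) N).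
  by apply/funext => N; rewrite subKr.
by rewrite /mkset -[part b ((_ *m _) i j)]subr0; exact: cvgB.
Qed.

Lemma expmx_adj M (s : R) : (expmx (s%:C%C *: M))^t* = expmx (s%:C%C *: M^t*).
Proof.
apply/matrixP => i j; apply: part_inj => b; rewrite !mxE part_conj.
have tM n : (M^t* ) ^+ n = (M ^+ n)^t*.
  elim: n => [|n ih].
    by rewrite !expr0 trmx1 map_mx1.
  by rewrite exprS ih exprSr trmx_mul map_mxM.
apply/esym; apply: cvg_unique (@part_expmx (M^t* ) s b i j) _ => //; rewrite /mkset.
rewrite (_ : exp_sum _ s = fun N => (-1) ^+ b * exp_sum (fun n => part b ((M ^+ n) j i)) s N).
  by apply: cvgMl_tmp; exact: part_expmx.
apply/funext => N; rewrite /exp_sum mulr_sumr; apply: eq_bigr => n _.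
by rewrite tM !mxE part_conj; ring.
Qed.

End MatrixExponential.

(** * Reflection of the line *)
Section Reflection.
Context {R : realType}.
Local Notation leb := (@lebesgue_measure R).

Lemma measurable_reflect (t : R) : measurable_fun setT (fun u : R => t - u).
Proof. exact: measurable_funB. Qed.

(** The reflection maps ]a, b] to [t - b, t - a[, of the same length, and the
    values on half-open intervals determine the measure. *)
Lemma lebesgue_measure_reflect (t : R) (A : set R) : measurable A ->
  leb ((fun u : R => t - u) @^-1` A) = leb A.
Proof.
move=> mA; apply/esym.
have mr : @measurable_fun _ _ (measurableTypeR R) (measurableTypeR R) setT
    (fun u : R => t - u) by exact: measurable_reflect.
pose r : {mfun (measurableTypeR R) >-> (measurableTypeR R)} := HB.pack (fun u : R => t - u)
  (isMeasurableFun.Build _ _ _ _ _ mr).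
have h (X : set R) : ocitv X -> leb X = pushforward leb r X.
  move=> [[a b] _ <-]; rewrite /pushforward /=.
  have -> : r @^-1` `]a, b]%classic = `[t - b, t - a[%classic.
    by apply/seteqP; split=> u /=; rewrite !in_itv/= => /andP[? ?]; apply/andP; split; lra.
  rewrite [LHS](lebesgue_measure_itv `]a, b]) [RHS](lebesgue_measure_itv `[t - b, t - a[)/=.
  rewrite !lte_fin ltrD2l ltrN2; case: ifP => // _.
  by rewrite -!EFinB; congr EFin; ring.
exact: (@lebesgue_measure_unique R (pushforward leb r) h A mA).
Qed.

Lemma Rintegral_reflect (t : R) (psi : R -> R) : measurable_fun setT psi ->
  leb.-integrable setT (EFin \o (fun u => psi (t - u))) ->
  \int[leb]_u psi (t - u) = \int[leb]_u psi u.
Proof.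
move=> mpsi ipsi; rewrite /Rintegral; congr fine.
have mr : @measurable_fun _ _ (measurableTypeR R) (measurableTypeR R) setT
    (fun u : R => t - u) by exact: measurable_reflect.
pose r : {mfun (measurableTypeR R) >-> (measurableTypeR R)} := HB.pack (fun u : R => t - u)
  (isMeasurableFun.Build _ _ _ _ _ mr).
have mE : @measurable_fun _ _ (measurableTypeR R) _ setT (EFin \o psi).
  by apply/measurable_EFinP.
have <- := @integral_pushforward _ _ (measurableTypeR R) (measurableTypeR R) R r mr leb setT _ mE ipsi measurableT.
by apply: eq_measure_integral => A mA _; exact: lebesgue_measure_reflect.
Qed.

Lemma cint_reflect (t : R) (K : R -> R[i]) :
  int_c leb setT (fun u => if u <= t then K (t - u) else 0) ->
  cint leb setT (fun u => if u <= t then K (t - u) else 0) =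
  cint leb `[0, +oo[%classic K.
Proof.
move=> iK; apply: part_inj => b; rewrite !part_cint [RHS]Rintegral_mkcond.
have := iK b; set phi := fun u => _ => iphi.
have mphi : measurable_fun setT phi.
  by apply/measurable_EFinP; have := measurable_int _ iphi.
set psi := patch _ _ _.
have phiE u : phi u = psi (t - u).
  rewrite /phi /psi patchE; case: ifPn => ut.
    by rewrite mem_set//= in_itv/= subr_ge0 ut.
  rewrite memNset ?part0//= in_itv/= subr_ge0 andbT; exact/negP.
have psiE u : psi u = phi (t - u) by rewrite phiE subKr.
rewrite -(@Rintegral_reflect t psi).
- by apply: eq_Rintegral => u _; exact: phiE.
- rewrite (_ : psi = phi \o (fun u => t - u)); last by apply/funext.
  by apply: measurableT_comp => //; exact: measurable_reflect.
- by rewrite (_ : (fun u => _) = phi)//; apply/funext => u; rewrite phiE.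
Qed.

End Reflection.

(** * Linearity of matrix integrals and null sets *)
Section MatrixIntegral.
Context {disp : measure_display} {T : measurableType disp} {R : realType}.
Variable mu : {measure set T -> \bar R}.

Lemma integral_mxE (D : set T) (a b : nat) (F : T -> 'M[R[i]]_(a, b)) i j :
  integral_mx mu D F i j = cint mu D (fun x => F x i j).
Proof. by rewrite mxE. Qed.

Lemma integral_mx_mull (D : set T) (a b c : nat) (E : 'M[R[i]]_(a, b))
    (F : T -> 'M[R[i]]_(b, c)) : measurable D ->
  (forall i j, int_c mu D (fun x => F x i j)) ->
  integral_mx mu D (fun x => E *m F x) = E *m integral_mx mu D F.
Proof.
move=> mD iF; apply/matrixP => i j; rewrite integral_mxE mxE.
under [RHS]eq_bigr do rewrite integral_mxE -cintZ//.
rewrite -cint_sum//; last by move=> k; exact: int_cZ.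
by congr cint; apply/funext => x; rewrite mxE.
Qed.

End MatrixIntegral.

Section AlmostEverywhereComplex.
Context {disp : measure_display} {Omega : measurableType disp} {R : realType}.
Variable P : probability Omega R.

Lemma cintM_ae (X Z X' Z' : Omega -> R[i]) :
  sqint_c P X -> sqint_c P Z ->
  (forall b, measurable_fun setT (fun w => part b (X' w))) ->
  (forall b, measurable_fun setT (fun w => part b (Z' w))) ->
  {ae P, forall w, X' w = X w} -> {ae P, forall w, Z' w = Z w} ->
  cint P setT (fun w => X' w * (Z' w)^*) = cint P setT (fun w => X w * (Z w)^*).
Proof.
move=> sX sZ mX' mZ' XX ZZ.
have aeX b : {ae P, forall w, part b (X w) = part b (X' w)}.
  by apply: filterS XX => w ->.
have aeZ b : {ae P, forall w, part b (Z w) = part b (Z' w)}.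
  by apply: filterS ZZ => w ->.
have sX' : sqint_c P X' by move=> b; apply: sqint_ae (mX' b) (aeX b) (sX b).
have sZ' : sqint_c P Z' by move=> b; apply: sqint_ae (mZ' b) (aeZ b) (sZ b).
have mX b : measurable_fun setT (fun w => part b (X w)) by case: (sX b).
have mZ b : measurable_fun setT (fun w => part b (Z w)) by case: (sZ b).
apply: part_inj => b; rewrite !part_cintM//.
have E b1 b2 := ip_ae (mX b1) (mZ b2) (mX' b1) (mZ' b2) (aeX b1) (aeZ b2).
by case: b; rewrite !E.
Qed.

End AlmostEverywhereComplex.

(** * The covariance function *)

(** In the proof, [E k] is exp(l R_k) and [K k k'] is the integrand of the k'-th
    term of Sigma_k; [fg] is the contribution of one pair of solvents. *)
Theorem proposition3p6 (R : realType) (disp : measure_display)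
    (Omega : measurableType disp) (P : probability Omega R)
    (d m p q : nat) (hd : (1 <= d)%N) (hm : (1 <= m)%N)
    (hq : (1 <= q)%N) (hpq : (q < p)%N)
    (A : nat -> 'M[R]_d) (B : nat -> 'M[R]_(d, m))
    (Ac : 'M[{poly R[i]}]_d) (hAc : Ac = ar_poly p (fun k => c_mx (A k)))
    (Bc : 'M[{poly R[i]}]_(d, m)) (hBc : Bc = ma_poly q (fun k => c_mx (B k)))
    (hirr : left_coprime (ar_poly p A) (ma_poly q B))
    (S : 'I_p -> 'M[R[i]]_d)
    (hreg : forall k, regular_right_solvent p (fun j => c_mx (A j)) (S k))
    (hcompl : complete_solvents (fun j => c_mx (A j)) S)
    (Gamma : 'I_p -> R -> R[i])
    (hGamma : forall k, residue_contour Ac (S k) (Gamma k))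
    (Res : 'I_p -> 'M[R[i]]_(d, m))
    (hRes : forall k, Res k = residue Ac Bc (Gamma k))
    (hspec : forall z : R[i], poly_spectrum Ac z -> complex.Re z < 0)
    (L : R -> Omega -> 'cV[R]_m) (hL : two_sided_levy P L)
    (hL2 : ('E_P[fun w => (\sum_i (L 1 w i ord0) ^+ 2)%R] < +oo)%E)
    (hL1 : forall i, ('E_P[fun w => (L 1 w i ord0)%R] = 0)%E)
    (SigmaL : 'M[R]_m) (hSigmaL : SigmaL = cov_matrix P (L 1))
    (Y : R -> Omega -> 'cV[R[i]]_d) (hY : mcarma_process P L S Res Y)
    (Sigma : 'I_p -> 'M[R[i]]_d)
    (hSigma : forall i, Sigma i =
       \sum_j integral_mx (@lebesgue_measure R) `[0, +oo[%classic
                (fun u : R => expmx (u%:C%C *: S i) *m Res i *m c_mx SigmaL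
                              *m (Res j)^t* *m expmx (u%:C%C *: (S j)^t*))) :
  forall (t : R) (l : nat),
    Cov P (Y (t + l%:R)) (Y t) = \sum_i expmx ((l%:R : R[i]) *: S i) *m Sigma i.
Proof.
move=> t l.
pose leb := @lebesgue_measure R.
have [mY [I hI YI]] := hY t.
have [mY' [I' hI' YI']] := hY (t + l%:R).
have I_sq k := levy_integral_sqint hL hL2 hL1 (hI k).
have I'_sq k := levy_integral_sqint hL hL2 hL1 (hI' k).
have s1 := sqint_cst P 1.
(* Y is centred, so the covariance is the mean of a product. *)
have mean0 s : mean_mx P (Y s) = 0.
  have [mYs [J hJ YJ]] := hY s.
  apply/matrixP => i j; rewrite (ord1 j) [LHS]integral_mxE mxE.
  apply: part_inj => b; rewrite part_cint part0.
  have J_sq k b' : sqint P (fun w => part b' (J k w i ord0)).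
    by have [_ h] := levy_integral_sqint hL hL2 hL1 (hJ k); exact: h.
  transitivity (mean P (fun w => \sum_k part b (J k w i ord0))).
    rewrite -[LHS]/(\int[P]_w part b (Y s w i ord0)).
    transitivity (mean P (fun w => part b (Y s w i ord0))).
      by rewrite /mean /ip; apply: eq_Rintegral => w _; rewrite mulr1.
    apply: ip_ae => //.
    - exact: measurable_mx_part.
    - by apply: measurable_sum => k; case: (J_sq k b).
    - by apply: filterS YJ => w ->; rewrite summxE part_sum.
    - exact: nearW.
  rewrite /mean ip_suml//; apply: big1 => k _.
  exact: (levy_integral_mean hL hL2 hL1 b i (hJ k)).
have -> : Cov P (Y (t + l%:R)) (Y t) =
    integral_mx P setT (fun w => Y (t + l%:R) w *m (Y t w)^t*).
  by rewrite /Cov !mean0 /mean_mx; congr integral_mx; apply/funext => w; rewrite !subr0.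
pose K k k' (u : R) := expmx (u%:C%C *: S k) *m Res k *m c_mx SigmaL
   *m (Res k')^t* *m expmx (u%:C%C *: (S k')^t*).
pose E k := expmx ((l%:R : R[i]) *: S k).
have fg k k' : integral_mx P setT (fun w => I' k w *m (I k' w)^t*) =
    E k *m integral_mx leb `[0, +oo[%classic (K k k').
  rewrite (levy_isometry hL hL2 hL1 (hI' k) (hI k')) -hSigmaL.
  have adj u : (expmx ((t - u)%:C%C *: S k') *m Res k')^t* =
      (Res k')^t* *m expmx ((t - u)%:C%C *: (S k')^t*).
    by rewrite trmx_mul map_mxM -expmx_adj.
  transitivity (integral_mx leb setT (fun u => E k *m
      (if u <= t then K k k' (t - u) else 0))).
    congr integral_mx; apply/funext => u; case: (leP u t) => ut; last first.
      by rewrite trmx0 map_mx0 !mulmx0.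
    have -> : u <= t + l%:R by rewrite (le_trans ut)// lerDl.
    have -> : t + l%:R - u = l%:R + (t - u) by ring.
    have lE : ((l%:R : R)%:C%C : R[i]) = l%:R by rewrite rmorph_nat.
    by rewrite (expmxD (S k) l%:R (t - u)) lE adj /K !mulmxA.
  (* a product of two square integrable kernels, the ones behind Y t *)
  have iK i j : int_c leb setT (fun u => (if u <= t then K k k' (t - u) else 0) i j).
    have sg := (I_sq k').1; have sf := (I_sq k).1.
    rewrite (_ : (fun u => _) = fun u => \sum_r
      (\sum_a (if u <= t then expmx ((t - u)%:C%C *: S k) *m Res k else 0) i a * c_mx SigmaL a r) *
      ((if u <= t then expmx ((t - u)%:C%C *: S k') *m Res k' else 0) j r)^*).
      apply: int_c_sum => // r; apply: int_cM; last exact: sg.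
      by apply: sqint_c_sum => a; apply: sqint_cZr; exact: sf.
    apply/funext => u; case: ifPn => ut.
      rewrite /K -mulmxA -adj mxE; apply: eq_bigr => r _.
      by rewrite !mxE.
    rewrite big1 ?mxE// => r _; rewrite big1 ?mul0r// => a _.
    by rewrite mxE mul0r.
  rewrite integral_mx_mull//; congr (_ *m _); apply/matrixP => i j.
  rewrite !integral_mxE -(@cint_reflect _ t); last first.
    move: (iK i j); congr int_c; apply/funext => u.
    by case: ifP => // _; rewrite mxE.
  congr cint; apply/funext => u.
  by case: ifP => // _; rewrite mxE.
apply/matrixP => i j; rewrite integral_mxE summxE.
transitivity (cint P setT (fun w => Y (t + l%:R) w i ord0 * (Y t w j ord0)^*)).
  by congr cint; apply/funext => w; rewrite mxE big_ord1 !mxE.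
(* replace Y by the sums of integrals that it equals almost surely *)
rewrite (@cintM_ae _ _ _ P (fun w => \sum_k I' k w i ord0) (fun w => \sum_k I k w j ord0)).
- transitivity (\sum_k \sum_k' (integral_mx P setT (fun w => I' k w *m (I k' w)^t*)) i j).
    have int2 k k' : int_c P setT (fun w => I' k w i ord0 * (I k' w j ord0)^*).
      by apply: int_cM; [exact: (I'_sq k).2|exact: (I_sq k').2].
    under [RHS]eq_bigr do under eq_bigr do rewrite integral_mxE.
    under [RHS]eq_bigr => k _.
      under eq_bigr => k' _.
        rewrite (_ : (fun w => _) = fun w => I' k w i ord0 * (I k' w j ord0)^*); last first.
          by apply/funext => w; rewrite mxE big_ord1 !mxE.
        over.
      rewrite -cint_sum//; over.
    rewrite -cint_sum//; last by move=> k; exact: int_c_sum.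
    congr cint; apply/funext => w; rewrite rmorph_sum mulr_suml.
    by apply: eq_bigr => k _; rewrite mulr_sumr.
  apply: eq_bigr => k _; under eq_bigr do rewrite fg.
  by rewrite -summxE -mulmx_sumr hSigma.
- by apply: sqint_c_sum => k; exact: (I'_sq k).2.
- by apply: sqint_c_sum => k; exact: (I_sq k).2.
- by move=> b; exact: measurable_mx_part.
- by move=> b; exact: measurable_mx_part.
- by apply: filterS YI' => w ->; rewrite summxE.
- by apply: filterS YI => w ->; rewrite summxE.
Qed.
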